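(* Let $l\geq 2$ and let $k_1\geq k_2\geq\cdots\geq k_l\geq 2$ be natural numbers with $k=k_1+\cdots+k_l$; call the sets of indices $\{\sum_{j=1}^{q-1}k_j+1,\dots,\sum_{j=1}^{q}k_j\}$, $q=1,\dots,l$, the blocks. Let $A_1=\operatorname{diag}(a_1,a_2,\dots,a_k)$ be a real diagonal matrix with $\operatorname{trace}(A_1)=\sum_{j=1}^k a_j=t>0$, such that (1) all $a_j$, $1\leq j\leq k$, are positive; (2) the numbers $a_j$ are pairwise equal within a given block; (3) the numbers $-a_i t$ are different in different blocks (that is, $a_i t\neq a_j t$ whenever $i$ and $j$ belong to different blocks). Let $\mathfrak{s}=\mathbb{R}f_1\ltimes\mathbb{R}^k$ be the solvable Lie algebra with basis $e_1,\dots,e_k,f_1$ whose only nonzero brackets among basis elements are $[f_1,e_i]=a_ie_i=-[e_i,f_1]$, $1\le i\le k$, let $Q$ be the inner product on $\mathfrak{s}$ for which this basis is orthonormal, let $\mathcal{S}$ be the simply connected Lie group with Lie algebra $\mathfrak{s}$, and let $\rho$ be the left-invariant Riemannian metric on $\mathcal{S}$ defined by $Q$. Let $H=SO(k_1)\times\cdots\times SO(k_l)$, where $SO(k_q)$ acts naturally on the span of the $e_i$ with index $i$ in the $q$-th block and trivially on $f_1$ and on the other $e_i$; then $\rho$ is invariant under the corresponding group $\mathcal{S}H=(H\times\mathbb{R})\ltimes\mathbb{R}^k$, and $\mathcal{S}=\mathcal{S}H/H$. Then $\mathcal{S}=\mathcal{S}H/H$ supplied with the invariant Riemannian metric $\rho$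 is not a geodesic orbit manifold.
   Context: A geodesic in a connected complete Riemannian manifold $(M,\mu)$ is homogeneous if it is an orbit of a 1-parameter subgroup of the full isometry group $I(M,\mu)$. The manifold $(M,\mu)$ is a geodesic orbit manifold if each of its geodesics is homogeneous. The numbers $-a_it$ in condition (3) are the eigenvalues of the Ricci operator of $(\mathfrak{s},Q)$ on the nilradical: in the basis $e_1,\dots,e_k,f_1$ the Ricci operator is $\operatorname{diag}(-ta_1,\dots,-ta_k,-\sum_{i=1}^k a_i^2)$. *)

(* Defs.v *)
(* MathComp + MathComp-Analysis, over an arbitrary R : realType. *)
From HB Require Import structures.
From mathcomp Require Import all_boot all_order all_algebra.
From mathcomp Require Import all_classical all_reals all_analysis.
From mathcomp Require Import ring.
Set Implicit Arguments.
Unset Strict Implicit.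
Unset Printing Implicit Defensive.
Import Order.TTheory GRing.Theory Num.Theory.
Import numFieldNormedType.Exports.
Local Open Scope classical_set_scope.
Local Open Scope ring_scope.

Section RiemannianGeometry.
(* The underlying manifold is always R^n with its global chart, and every
   tangent space is identified with 'rV[R]_n by that chart. *)
Variables (R : realType) (n : nat).
Implicit Types (p v w : 'rV[R]_n) (i j m : 'I_n).

Definition partial i (f : 'rV[R]_n -> R) p : R := 'D_(delta_mx 0 i) f p.

Fixpoint Ck (r : nat) (f : 'rV[R]_n -> R) : Prop :=
  continuous f /\
  if r is r'.+1 then
    (forall i p, derivable f p (delta_mx 0 i)) /\
    (forall i, Ck r' (partial i f))
  else True.

Definition smooth_map (n' : nat) (f : 'rV[R]_n -> 'rV[R]_n') : Prop :=
  forall (r : nat) (j : 'I_n'), Ck r (fun p => f p 0 j).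

Definition smooth_diffeo (f : 'rV[R]_n -> 'rV[R]_n) : Prop :=
  smooth_map f /\
  exists f' : 'rV[R]_n -> 'rV[R]_n,
    [/\ smooth_map f', cancel f f' & cancel f' f].

(* g p v w is the scalar product of the tangent vectors v, w at p. *)
Variable g : 'rV[R]_n -> 'rV[R]_n -> 'rV[R]_n -> R.

Definition gram p : 'M[R]_n :=
  \matrix_(i, j) g p (delta_mx 0 i) (delta_mx 0 j).

(* Christoffel symbol Gamma^m_(i j) of the Levi-Civita connection. *)
Definition christoffel p m i j : R :=
  2^-1 * \sum_(s < n) invmx (gram p) m s *
    (partial i (fun q => gram q j s) p
     + partial j (fun q => gram q i s) p
     - partial s (fun q => gram q i j) p).

(* Geodesics are defined on the whole line: the notion is meant for complete
   metrics. *)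
Definition geodesic (c : R -> 'rV[R]_n) : Prop :=
  (forall s, derivable c s 1) /\
  (forall s, derivable (derive1 c) s 1) /\
  (forall s m, derive1 (derive1 c) s 0 m
     + \sum_(i < n) \sum_(j < n)
         christoffel (c s) m i j * derive1 c s 0 i * derive1 c s 0 j = 0).

Definition riemannian_isometry (f : 'rV[R]_n -> 'rV[R]_n) : Prop :=
  smooth_diffeo f /\
  forall p v w, g (f p) ('D_v f p) ('D_w f p) = g p v w.

(* A continuous homomorphism from (R, +) to the full isometry group, the
   latter with the compact-open topology; phi 0 = id follows from the first
   two clauses since isometries are injective. *)
Definition one_parameter_subgroup (phi : R -> 'rV[R]_n -> 'rV[R]_n) : Prop :=
  [/\ forall s, riemannian_isometry (phi s),
      forall s s', phi (s + s') = phi s \o phi s'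
    & continuous (phi : R -> {compact-open, 'rV[R]_n -> 'rV[R]_n})].

Definition homogeneous_geodesic (c : R -> 'rV[R]_n) : Prop :=
  exists (phi : R -> 'rV[R]_n -> 'rV[R]_n) p,
    one_parameter_subgroup phi /\ range c = range (fun s => phi s p).

Definition geodesic_orbit : Prop :=
  forall c, geodesic c -> homogeneous_geodesic c.

Definition field_bracket (X Y : 'rV[R]_n -> 'rV[R]_n) p : 'rV[R]_n :=
  'D_(X p) Y p - 'D_(Y p) X p.

End RiemannianGeometry.

Section DeriveAux.
Variable R : realType.

Fact derive_affine n m (L : 'M[R]_(n, m)) (b : 'rV[R]_m) (v x : 'rV[R]_n) :
  'D_v (fun q : 'rV[R]_n => b + q *m L) x = v *m L.
Proof.
rewrite /derive; apply: cvg_lim => //.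
apply: cvg_near_cst.
near=> h.
rewrite /= mulmxDl -scalemxAl opprD addrACA subrr add0r addrK.
by rewrite scalerA mulVf ?scale1r //; near: h; exact: nbhs_dnbhs_neq.
Unshelve. all: by end_near.
Qed.

Fact is_derive_line (V W : normedModType R) (f : V -> W) (p v : V) (d : W) :
  is_derive (0 : R) 1 (fun h => f (h *: v + p)) d -> is_derive p v f d.
Proof.
case=> df <-; split; first exact/derivable1P.
rewrite /derive /=; congr (lim (_ @ 0^')); apply/funext => h /=.
by rewrite !addr0 scale0r add0r [h *: 1]mulr1.
Qed.

End DeriveAux.

Section Solvable.
Variables (R : realType) (k : nat) (a : 'rV[R]_k).
Local Notation V := 'rV[R]_(k + 1).
Implicit Types (p q v w : V) (u : R) (x : 'rV[R]_k).

(* The basis e_1, ..., e_k, f_1 is the standard basis of 'rV[R]_(k + 1), in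
   this order. *)
Definition mkS x u : V := row_mx x u%:M.
Definition e_part p : 'rV[R]_k := lsubmx p.
Definition f_part p : R := rsubmx p 0 0.
Definition e_ (i : 'I_k) : V := delta_mx 0 (lshift 1 i).
Definition f_1 : V := delta_mx 0 (rshift k 0).

Definition s_bracket v w : V :=
  mkS ((f_part v *: e_part w - f_part w *: e_part v) *m diag_mx a) 0.

Definition s_inner v w : R := (v *m w^T) 0 0.

(* exp (u * diag_mx a) *)
Definition expA u : 'M[R]_k := diag_mx (\row_i expR (u * a 0 i)).

(* The simply connected Lie group of s, modelled on R^(k+1): the semidirect
   product of R^k by R acting through expA. *)
Definition S_mul p q : V :=
  mkS (e_part p + e_part q *m expA (f_part p)) (f_part p + f_part q).
Definition S_one : V := 0.
Definition S_inv p : V := mkS (- e_part p *m expA (- f_part p)) (- f_part p).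

Lemma e_part_mkS x u : e_part (mkS x u) = x.
Proof. by rewrite /e_part row_mxKl. Qed.

Lemma f_part_mkS x u : f_part (mkS x u) = u.
Proof. by rewrite /f_part row_mxKr mxE. Qed.

Lemma mkS_parts p : mkS (e_part p) (f_part p) = p.
Proof.
rewrite /mkS /e_part /f_part -[RHS]hsubmxK; congr row_mx.
by rewrite -mx11_scalar.
Qed.

Lemma expA0 : expA 0 = 1%:M.
Proof. by apply/matrixP => i j; rewrite !mxE mul0r expR0. Qed.

Lemma expAD u u' : expA (u + u') = expA u *m expA u'.
Proof.
rewrite /expA mulmx_diag; congr diag_mx; apply/rowP => i.
by rewrite !mxE mulrDl expRD.
Qed.

Lemma S_mulA : associative S_mul.
Proof.
move=> p q w; rewrite /S_mul !(e_part_mkS, f_part_mkS); congr mkS.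
  by rewrite mulmxDl addrA -mulmxA -expAD [f_part q + _]addrC.
by rewrite addrA.
Qed.

Lemma S_mul1l : left_id S_one S_mul.
Proof.
move=> p; have e0 : e_part S_one = 0 by rewrite /e_part /S_one linear0.
have f0 : f_part S_one = 0 by rewrite /f_part !mxE.
by rewrite /S_mul e0 f0 expA0 mulmx1 !add0r mkS_parts.
Qed.

Lemma S_mulV : left_inverse S_one S_inv S_mul.
Proof.
move=> p; rewrite /S_mul /S_inv !(e_part_mkS, f_part_mkS).
rewrite mulNmx !addNr /mkS /S_one.
by rewrite (_ : 0%:M = 0) ?row_mx0 //; apply/matrixP => i j; rewrite !mxE mul0rn.
Qed.

Definition left_invariant_field v p : V := 'D_v (S_mul p) S_one.

(* The left-invariant metric equal to s_inner at S_one. *)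
Definition rho p v w : R :=
  s_inner ('D_v (S_mul (S_inv p)) p) ('D_w (S_mul (S_inv p)) p).

Fact S_mulE p :
  S_mul p = fun q => p + q *m block_mx (expA (f_part p)) 0 0 1%:M.
Proof.
apply/funext => q.
rewrite /S_mul -{3}[q]hsubmxK mul_row_block !mulmx0 addr0 add0r mulmx1.
rewrite -[X in _ = X + row_mx _ _]hsubmxK add_row_mx /mkS; congr row_mx.
by rewrite raddfD /= -!mx11_scalar.
Qed.

Lemma left_invariant_fieldE v p :
  left_invariant_field v p = mkS (e_part v *m expA (f_part p)) (f_part v).
Proof.
rewrite /left_invariant_field S_mulE derive_affine -{1}[v]hsubmxK mul_row_block !mulmx0 addr0 add0r mulmx1.
by rewrite /mkS -mx11_scalar.
Qed.

Lemma rhoE p v w :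
  rho p v w = \sum_(i < k) expR (- (2 * f_part p * a 0 i))
                                 * e_part v 0 i * e_part w 0 i
              + f_part v * f_part w.
Proof.
rewrite /rho S_mulE !derive_affine /s_inner -{1}[v]hsubmxK -{1}[w]hsubmxK.
rewrite !mul_row_block !mulmx0 !addr0 !add0r !mulmx1.
rewrite tr_row_mx mul_row_col mxE addrC [RHS]addrC; congr (_ + _).
  by rewrite mxE big_ord1 /f_part !mxE.
rewrite mxE; apply: eq_bigr => i _.
rewrite f_part_mkS /expA !mul_mx_diag !mxE.
have -> : expR (- (2 * f_part p * a 0 i)) =
    expR (- f_part p * a 0 i) * expR (- f_part p * a 0 i).
  by rewrite -expRD; congr expR; ring.
by ring.
Qed.

Lemma derive_left_invariant_field w v p :
  'D_v (left_invariant_field w) p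
  = mkS (f_part v *: (e_part w *m diag_mx a *m expA (f_part p))) 0.
Proof.
have dc j : is_derive p v (fun q => left_invariant_field w q 0 j)
   (mkS (f_part v *: (e_part w *m diag_mx a *m expA (f_part p))) 0 0 j).
  rewrite -(splitK j); case: (fintype.split j) => i /=.
    rewrite (_ : (fun q => _) =
        (fun q => e_part w 0 i * expR (f_part q * a 0 i))); last first.
      apply/funext => q; rewrite left_invariant_fieldE /mkS row_mxEl.
      by rewrite /expA mul_mx_diag !mxE.
    rewrite /mkS row_mxEl mxE /expA !mul_mx_diag !mxE.
    apply: is_derive_line.
    rewrite (_ : (fun h => _) =
        e_part w 0 i *: (expR \o
          (fun h : R => h * (f_part v * a 0 i) + f_part p * a 0 i))); last first.
      apply/funext => h /=; rewrite /f_part !mxE.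
      rewrite [RHS]/(_ * expR (h * (v 0 (rshift k 0) * a 0 i)
                                 + p 0 (rshift k 0) * a 0 i)).
      by congr (_ * expR _); rewrite mulrDl -mulrA.
    have d1 : is_derive (0 : R) 1 (fun h : R =>
        h * (f_part v * a 0 i) + f_part p * a 0 i) (f_part v * a 0 i).
      rewrite (_ : (fun h => _) = (f_part v * a 0 i) *: id
          + cst (f_part p * a 0 i)); last first.
        by apply/funext => h /=; rewrite mulrC.
      by apply: is_derive_eq; rewrite addr0 [_ *: 1]mulr1.
    have d2 := is_derive1_comp (is_derive_expR _) d1.
    apply: (is_derive_eq (is_deriveZ (e_part w 0 i) d2)).
    rewrite mul0r add0r /GRing.scale /= /e_part ?mxE.
    ring.
  rewrite (_ : (fun q => _) = cst (f_part w)); last first.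
    apply/funext => q; rewrite left_invariant_fieldE /mkS row_mxEr.
    by rewrite ord1 mxE mulr1n.
  by rewrite /mkS row_mxEr !mxE mul0rn; exact: is_derive_cst.
have dm : derivable (left_invariant_field w) p v.
  by apply/derivable_mxP => i j; rewrite ord1; have [] := dc j.
rewrite derive_mx //; apply/rowP => j; rewrite mxE.
by have [_ <-] := dc j.
Qed.

Lemma field_bracket_left_invariant v w p :
  field_bracket (left_invariant_field v) (left_invariant_field w) p
  = left_invariant_field (s_bracket v w) p.
Proof.
rewrite /field_bracket !derive_left_invariant_field !left_invariant_fieldE.
rewrite /s_bracket !(e_part_mkS, f_part_mkS) /mkS opp_row_mx add_row_mx.
rewrite raddf0 subr0; congr row_mx.
by rewrite !mulmxBl -!scalemxAl.
Qed.

Lemma s_bracket_basis :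
  (forall i, s_bracket (f_1) (e_ i) = a 0 i *: e_ i) /\
  (forall i j, s_bracket (e_ i) (e_ j) = 0).
Proof.
have fe i : f_part (e_ i) = 0 :> R.
  by rewrite /f_part /e_ !mxE eq_rlshift.
have ff : f_part (f_1) = 1 by rewrite /f_part /f_1 !mxE !eqxx.
split=> [i|i j].
  rewrite /s_bracket fe ff scale1r scale0r subr0 /mkS.
  rewrite -[RHS]hsubmxK; congr row_mx.
    apply/rowP => j; rewrite mul_mx_diag /e_part !mxE mulrC.
    by rewrite /e_ eq_lshift; case: (eqVneq j i) => [->|_]; rewrite ?mulr1 ?mulr0.
  by apply/rowP => j; rewrite ord1 /e_ !mxE eq_rlshift mulr0 mul0rn.
by rewrite /s_bracket !fe !scale0r subr0 mul0mx /mkS raddf0 row_mx0.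
Qed.
(* The linear action of h on s fixing f_1; if h commutes with diag_mx a it is
   also an automorphism of S.  Vectors are rows, whence the transpose. *)
Definition h_act (h : 'M[R]_k) p : V := mkS (e_part p *m h^T) (f_part p).

(* Elements ((h, u), x) of the semidirect product of R^k by H x R. *)
Definition SH_type := ('M[R]_k * R * 'rV[R]_k)%type.

Definition SH_mul (z z' : SH_type) : SH_type :=
  (z.1.1 *m z'.1.1, z.1.2 + z'.1.2,
   z.2 + z'.2 *m z.1.1^T *m expA z.1.2).

Definition SH_of_H (h : 'M[R]_k) : SH_type := (h, 0, 0).

Definition SH_act (z : SH_type) p : V :=
  S_mul (mkS z.2 z.1.2) (h_act z.1.1 p).

End Solvable.

Section Blocks.
Variables (R : realType) (l : nat) (ks : 'I_l -> nat).

(* Indices are numbered from 0. *)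
Definition block (q : 'I_l) : {set 'I_(\sum_(j < l) ks j)%N} :=
  [set i : 'I_(\sum_(j < l) ks j)%N |
    (\sum_(j < l | j < q) ks j <= i < \sum_(j < l | j <= q) ks j)%N].

Definition SO (m : nat) : set 'M[R]_m :=
  [set B | B *m B^T = 1%:M /\ \det B = 1].

Definition prod_SO : set 'M[R]_(\sum_(j < l) ks j)%N :=
  [set \mxdiag_(q < l) B q | B in [set B : forall q, 'M[R]_(ks q) |
                                    forall q, SO (B q)]].

Definition SH : set (SH_type R (\sum_(j < l) ks j)%N) :=
  [set z | prod_SO z.1.1].

End Blocks.
Arguments SO : clear implicits.
Arguments prod_SO : clear implicits.
Arguments SH : clear implicits.

(* Main.v *)
Require Import Defs.
From mathcomp Require Import all_boot all_order all_algebra.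
From mathcomp Require Import all_classical all_reals all_analysis.
From mathcomp Require Import ring lra.
Import Order.TTheory GRing.Theory Num.Theory.
Import numFieldNormedType.Exports.
Local Open Scope classical_set_scope.
Local Open Scope ring_scope.

(** Write u for the coordinate along f_1 and al_m for a_m, extended by 0 to the
   u-direction, so that rho is the warped metric sum_m exp(-2 al_m u) dx_m^2.

   The first four claims are computations in the semidirect product: a matrix
   of H commutes with exp(u A_1) because A_1 is scalar on every block, and it
   is orthogonal, so that S H acts by affine isometries.

   For the last claim, every isometry f, not only those in S H, is shown to
   satisfy u (f p) = c u(p) + d with c = 1 or c = -1 [isometry_height]: the
   isometry group fixes the point at infinity of the vertical lines.  The
   translations along the x_m and the one-parameter group of left translations
   along f_1 give Killing fields; their pull-backs by f are again Killing.
   The Killing equations of rho force the vertical component of a Killing field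
   to be constant as soon as every a_m differs from another one
   [killing_vertical_cst], which is the case when there are at least two
   blocks.  (In real hyperbolic space, where all a_m are equal, the
   special conformal fields of the boundary extend to Killing fields whose
   vertical component is a nonconstant affine function.)  The constants
   obtained for the pulled back fields determine the vertical derivative of f,
   and since it has norm 1 at every point of the image of f, which is the whole
   space, f maps the vertical unit field to itself or to its opposite
   [iso_height].

   Consequently the members phi_s = phi_(s/2) o phi_(s/2) of a one-parameter
   group of isometries translate the height by a constant.  If such a group had
   a geodesic as an orbit, the height along this geodesic would be constant or
   unbounded above.  But the plane spanned by e_i and f_1 is a hyperbolic plane,
   and its geodesic [semicircle] is a half circle on which the height has a
   strict maximum; hence that geodesic is not homogeneous. *)

(** * Partial derivatives of smooth functions *)

Section PartialDerivatives.
Set Implicit Arguments.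
Unset Strict Implicit.
Variables (R : realType) (n : nat).
Local Notation V := 'rV[R]_n.
Implicit Types (f g : V -> R) (p v w : V) (i j : 'I_n) (r : nat).

Definition smooth_fun f : Prop := forall r, Ck r f.

Lemma is_derive_along f p v (s : R) :
  derivable f (s *: v + p) v ->
  is_derive s (1 : R) (fun h => f (h *: v + p)) ('D_v f (s *: v + p)).
Proof.
have E : (fun h : R => h^-1 *: (((fun h => f (h *: v + p)) \o shift s) (h *: (1 : R))
             - f (s *: v + p)))
       = (fun h : R => h^-1 *: ((f \o shift (s *: v + p)) (h *: v) - f (s *: v + p))).
  by apply/funext => h /=; rewrite [h *: 1]mulr1 scalerDl addrA.
move=> df; split; first by rewrite /derivable E.
by rewrite /derive E.
Qed.

Lemma is_derive_mulfun (W : normedModType R) (f g : W -> R) (p v : W) df dg :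
  is_derive p v f df -> is_derive p v g dg ->
  is_derive p v (fun q => f q * g q) (df * g p + f p * dg).
Proof.
move=> Hf Hg; apply: (is_derive_eq (is_deriveM Hf Hg)).
by rewrite addrC; congr (_ + _); rewrite /GRing.scale /= mulrC.
Qed.

Lemma is_derive_expfun f p v df : is_derive p v f df ->
  is_derive p v (fun q => expR (f q)) (df * expR (f p)).
Proof.
move=> Hf; have [fd <-] := Hf.
apply: is_derive_line.
have := @is_derive_along f p v 0.
rewrite scale0r add0r => /(_ fd) D1.
have := is_derive1_comp (is_derive_expR (f (0 *: v + p))) D1.
by rewrite scale0r add0r mulrC.
Qed.

Lemma Ck_continuous r f : Ck r f -> continuous f.
Proof. by case: r => [|r] []. Qed.

Lemma Ck_derivable r i f p : Ck r.+1 f -> derivable f p (delta_mx 0 i).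
Proof. by case=> _ [+ _] => /(_ i p). Qed.

Lemma Ck_partial r i f : Ck r.+1 f -> Ck r (partial i f).
Proof. by case=> _ [_ +] => /(_ i). Qed.

Lemma Ck_is_derive r i f p : Ck r.+1 f ->
  is_derive p (delta_mx 0 i : V) f (partial i f p).
Proof. by move=> Hf; apply/derivableP; exact: Ck_derivable Hf. Qed.

(** [Ck] is stated with the totalized operator [partial]; this form lets the
   derivatives be computed by [is_derive] rules. *)
Lemma Ck_intro r f (df : 'I_n -> V -> R) : continuous f ->
  (forall i p, is_derive p (delta_mx 0 i : V) f (df i p)) ->
  (forall i, Ck r (df i)) -> Ck r.+1 f.
Proof.
move=> cf df1 df2; split=> //; split=> [i p|i]; first by have [] := df1 i p.
rewrite (_ : partial i f = df i) //; apply/funext => p.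
by have [_ <-] := df1 i p.
Qed.

Lemma CkW r f : Ck r.+1 f -> Ck r f.
Proof.
elim: r f => [|r IH] f Hf; first by split; [exact: Ck_continuous Hf|].
apply: (@Ck_intro r f (fun i => partial i f)); first exact: Ck_continuous Hf.
- by move=> i p; exact: Ck_is_derive Hf.
- by move=> i; apply: IH; exact: Ck_partial Hf.
Qed.

Lemma Ck_cst r (c : R) : Ck r (fun _ : V => c).
Proof.
elim: r c => [|r IH] c; first by split=> //; exact: cst_continuous.
apply: (@Ck_intro r _ (fun _ _ => 0)); first exact: cst_continuous.
by move=> i; exact: (IH 0).
Qed.

Lemma CkD r f g : Ck r f -> Ck r g -> Ck r (fun q => f q + g q).
Proof.
elim: r f g => [|r IH] f g Hf Hg.
  by split=> // p; apply: continuousD; [case: Hf => + _|case: Hg => + _]; apply.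
apply: (@Ck_intro r _ (fun i q => partial i f q + partial i g q)).
- move=> p; apply: continuousD; first exact: Ck_continuous Hf p.
  exact: Ck_continuous Hg p.
- by move=> i p; apply: is_deriveD; [exact: Ck_is_derive Hf|exact: Ck_is_derive Hg].
- by move=> i; apply: IH; [exact: Ck_partial Hf|exact: Ck_partial Hg].
Qed.

Lemma CkM r f g : Ck r f -> Ck r g -> Ck r (fun q => f q * g q).
Proof.
elim: r f g => [|r IH] f g Hf Hg.
  by split=> // p; apply: continuousM; [case: Hf => + _|case: Hg => + _]; apply.
apply: (@Ck_intro r _ (fun i q => partial i f q * g q + f q * partial i g q)).
- move=> p; apply: continuousM; first exact: Ck_continuous Hf p.
  exact: Ck_continuous Hg p.
- by move=> i p; apply: is_derive_mulfun; [exact: Ck_is_derive Hf|exact: Ck_is_derive Hg].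
- move=> i; apply: CkD; apply: IH;
    [exact: Ck_partial Hf|exact: CkW|exact: CkW|exact: Ck_partial Hg].
Qed.

Lemma Ck_expR r f : Ck r f -> Ck r (fun q => expR (f q)).
Proof.
have C g : continuous g -> continuous (fun q : V => expR (g q)).
  by move=> cg p; apply: continuous_comp; [exact: cg|exact: continuous_expR].
elim: r f => [|r IH] f Hf; first by split=> //; apply: C; case: Hf.
apply: (@Ck_intro r _ (fun i q => partial i f q * expR (f q))).
- by apply: C; exact: Ck_continuous Hf.
- by move=> i p; apply: is_derive_expfun; exact: Ck_is_derive Hf.
- by move=> i; apply: CkM; [exact: Ck_partial Hf|apply: IH; exact: CkW].
Qed.

Lemma smooth_fun_partial i f : smooth_fun f -> smooth_fun (partial i f).
Proof. by move=> Hf r; apply: Ck_partial (Hf r.+1). Qed.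

Lemma smooth_is_derive i f p : smooth_fun f ->
  is_derive p (delta_mx 0 i : V) f (partial i f p).
Proof. by move=> Hf; exact: Ck_is_derive (Hf 1%N). Qed.

Lemma smooth_cst (c : R) : smooth_fun (fun=> c).
Proof. by move=> r; exact: Ck_cst. Qed.

Lemma smooth_add f g : smooth_fun f -> smooth_fun g -> smooth_fun (fun q => f q + g q).
Proof. by move=> Hf Hg r; exact: CkD. Qed.

Lemma smooth_mul f g : smooth_fun f -> smooth_fun g -> smooth_fun (fun q => f q * g q).
Proof. by move=> Hf Hg r; exact: CkM. Qed.

Lemma smooth_exp f : smooth_fun f -> smooth_fun (fun q => expR (f q)).
Proof. by move=> Hf r; exact: Ck_expR. Qed.

Lemma smooth_sum I (s : seq I) (F : I -> V -> R) :
  (forall m, smooth_fun (F m)) -> smooth_fun (fun q => \sum_(m <- s) F m q).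
Proof.
move=> HF; elim: s => [|m s IH].
  by under eq_fun do rewrite big_nil; exact: smooth_cst.
by under eq_fun do rewrite big_cons; apply: smooth_add.
Qed.

Lemma smooth_coord i : smooth_fun (fun q => q 0 i).
Proof.
case=> [|r]; first by split=> // p; exact: coord_continuous.
apply: (@Ck_intro r _ (fun j _ => (i == j)%:R)); first exact: coord_continuous.
  move=> j p; apply: is_derive_line.
  rewrite (_ : (fun h => _) = (i == j)%:R *: (id : R -> R) + cst (p 0 i)); last first.
    by apply/funext => h /=; rewrite !mxE eqxx /= mulrC.
  by apply: is_derive_eq; rewrite addr0 [_ *: 1]mulr1.
by move=> j; exact: Ck_cst.
Qed.

Lemma partial_coord i j p : partial j (fun q => q 0 i) p = (i == j)%:R.
Proof.
have [_ <-] := smooth_is_derive j p (smooth_coord i).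
have := @is_derive_line R V R (fun q => q 0 i) p (delta_mx 0 j) (i == j)%:R.
case=> //; rewrite (_ : (fun h => _) = (i == j)%:R *: (id : R -> R) + cst (p 0 i)).
  by apply: is_derive_eq; rewrite addr0 [_ *: 1]mulr1.
by apply/funext => h /=; rewrite !mxE eqxx /= mulrC.
Qed.

Lemma partial_cst i (c : R) p : partial i (fun=> c) p = 0.
Proof. by rewrite /partial; exact: derive_cst. Qed.

Lemma partial_add i f g p : smooth_fun f -> smooth_fun g ->
  partial i (fun q => f q + g q) p = partial i f p + partial i g p.
Proof.
move=> /(smooth_is_derive i p) Hf /(smooth_is_derive i p) Hg.
by have [_ <-] := is_deriveD Hf Hg.
Qed.

Lemma partial_mul i f g p : smooth_fun f -> smooth_fun g ->
  partial i (fun q => f q * g q) p = partial i f p * g p + f p * partial i g p.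
Proof.
move=> /(smooth_is_derive i p) Hf /(smooth_is_derive i p) Hg.
by have [_ <-] := is_derive_mulfun Hf Hg.
Qed.

Lemma partial_exp i f p : smooth_fun f ->
  partial i (fun q => expR (f q)) p = partial i f p * expR (f p).
Proof.
move=> /(smooth_is_derive i p) Hf.
by have [_ <-] := is_derive_expfun Hf.
Qed.

Lemma partial_scale i (c : R) f p : smooth_fun f ->
  partial i (fun q => c * f q) p = c * partial i f p.
Proof.
move=> Hf; rewrite (partial_mul i p (smooth_cst c) Hf).
by rewrite partial_cst mul0r add0r.
Qed.

Lemma partial_sum i I (s : seq I) (F : I -> V -> R) p :
  (forall m, smooth_fun (F m)) ->
  partial i (fun q => \sum_(m <- s) F m q) p = \sum_(m <- s) partial i (F m) p.
Proof.
move=> HF; elim: s => [|m s IH].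
  by under eq_fun do rewrite big_nil; rewrite partial_cst big_nil.
under eq_fun do rewrite big_cons; rewrite big_cons -IH partial_add //.
exact: smooth_sum.
Qed.

Lemma mean_value_along f p v (h : R) : 0 < h ->
  (forall q, derivable f q v) ->
  exists2 s, 0 <= s <= h & f (h *: v + p) - f p = h * 'D_v f (s *: v + p).
Proof.
move=> h0 df.
have dl s : is_derive s (1 : R) (fun h => f (h *: v + p)) ('D_v f (s *: v + p)).
  exact: is_derive_along.
have cl : {within `[0, h], continuous (fun h => f (h *: v + p))}.
  by apply: derivable_within_continuous => s _; have [] := dl s.
have [s sh] := MVT h0 (fun s _ => dl s) cl.
rewrite scale0r add0r subr0 => E; exists s; last by rewrite E mulrC.
by move: sh; rewrite in_itv /= => /andP[/ltW -> /ltW ->].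
Qed.

(** Two applications of the mean value theorem, first to the increment in the
   direction j as a function of the direction i; the left-hand side is
   symmetric in i and j, which is the point of Schwarz's theorem. *)
Lemma second_difference f i j p (h : R) : Ck 2 f -> 0 < h ->
  exists s t, [/\ 0 <= s <= h, 0 <= t <= h &
    f (h *: delta_mx 0 i + (h *: delta_mx 0 j + p)) - f (h *: delta_mx 0 i + p)
    - f (h *: delta_mx 0 j + p) + f p
    = h * h * partial j (partial i f) (t *: delta_mx 0 j + (s *: delta_mx 0 i + p))].
Proof.
move=> Hf h0.
set v := delta_mx 0 i; set w := delta_mx 0 j.
have dv q : derivable f q v by exact: Ck_derivable Hf.
have dw q : derivable (partial i f) q w by apply: Ck_derivable (Ck_partial i Hf).
pose g q := f (h *: w + q) - f q.
have isg q : is_derive q v g (partial i f (h *: w + q) - partial i f q).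
  apply: (@is_deriveB _ _ _ (fun q => f (h *: w + q)) f); last exact/derivableP.
  apply: is_derive_line.
  rewrite (_ : (fun s => _) = (fun s : R => f (s *: v + (h *: w + q)))); last first.
    by apply/funext => s; rewrite addrCA.
  have := @is_derive_along f (h *: w + q) v 0.
  by rewrite scale0r add0r; apply; exact: dv.
have dg q : derivable g q v by have [] := isg q.
have [s sh E1] := mean_value_along p h0 dg.
have [t th E2] := mean_value_along (s *: v + p) h0 dw.
exists s, t; split=> //.
have [_ E3] := isg (s *: v + p).
rewrite -mulrA -[partial j _ _]/('D_w (partial i f) _) -E2.
by rewrite -E3 -E1 /g (addrCA (h *: w)); ring.
Qed.

(** Both iterated derivatives take the same value at points arbitrarily close to
   p, by [second_difference] in the two orders, and both are continuous. *)
Lemma partialC f i j : Ck 2 f -> partial i (partial j f) = partial j (partial i f).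
Proof.
move=> Hf; apply/funext => p; apply/eqP; rewrite -subr_eq0 -normr_le0.
apply/ler_addgt0Pl => e e0; rewrite addr0.
have near_partial : forall i j : 'I_n, exists2 d : R, 0 < d &
    forall s t : R, 0 <= s <= d -> 0 <= t <= d ->
    `|partial j (partial i f) (t *: delta_mx 0 j + (s *: delta_mx 0 i + p))
      - partial j (partial i f) p| <= e / 2.
  move=> {}i {}j; have cj := Ck_continuous (Ck_partial j (Ck_partial i Hf)).
  have /cvgrPdist_le /(_ (e / 2)) := cj p.
  rewrite divr_gt0 // => /(_ isT) /nbhs_ballP [d /= d0 Hd].
  set M := `|delta_mx 0 j : V| + `|delta_mx 0 i : V| + 1.
  have M0 : 0 < M by rewrite ltr_wpDl // addr_ge0.
  exists (d / 2 / M); first by rewrite !divr_gt0.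
  move=> s t /andP[s0 sd] /andP[t0 td].
  rewrite distrC; apply: Hd; rewrite -ball_normE /=.
  rewrite addrA opprD addrCA subrr addr0 normrN.
  apply: le_lt_trans (ler_normD _ _) _; rewrite !normrZ !ger0_norm //.
  apply: (@le_lt_trans _ _ (d / 2 / M * M)); last first.
    by rewrite divfK ?gt_eqF // ltr_pdivrMr // ltr_pMr // ltr1n.
  have K0 : 0 < d / 2 / M by rewrite !divr_gt0.
  apply: (@le_trans _ _ (d / 2 / M * (`|delta_mx 0 j : V| + `|delta_mx 0 i : V|))).
    by rewrite mulrDr lerD // ler_wpM2r.
  by rewrite ler_wpM2l ?(ltW K0) // lerDl.
have [d1 d10 H1] := near_partial i j.
have [d2 d20 H2] := near_partial j i.
pose h := Num.min d1 d2.
have h0 : 0 < h by rewrite lt_min d10.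
have [s [t [/andP[s0 sh] /andP[t0 th] E1]]] := second_difference i j p Hf h0.
have [s' [t' [/andP[s'0 s'h] /andP[t'0 t'h] E2]]] := second_difference j i p Hf h0.
have hd1 : h <= d1 by rewrite ge_min lexx.
have hd2 : h <= d2 by rewrite ge_min lexx orbT.
have := H1 s t; rewrite s0 t0 (le_trans sh) // (le_trans th) // => /(_ isT isT) A1.
have := H2 s' t'; rewrite s'0 t'0 (le_trans s'h) // (le_trans t'h) // => /(_ isT isT) A2.
have hh : h * h != 0 by rewrite mulf_neq0 // gt_eqF.
have E : partial j (partial i f) (t *: delta_mx 0 j + (s *: delta_mx 0 i + p))
       = partial i (partial j f) (t' *: delta_mx 0 i + (s' *: delta_mx 0 j + p)).
  apply: (mulfI hh).
  apply: etrans (etrans _ E2); first exact: esym E1.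
  by rewrite (addrCA (h *: delta_mx 0 i)); ring.
rewrite {}E in A1.
set x := partial i (partial j f) _ in A1 A2.
set y := partial i (partial j f) p; set z := partial j (partial i f) p.
rewrite (_ : y - z = (x - z) - (x - y)); last by ring.
apply: le_trans (ler_normB _ _) _.
by rewrite (splitr e); apply: lerD; [exact: A1|exact: A2].
Qed.

(** Any two points are joined by a path of segments parallel to the axes. *)
Lemma partial0_cst f : smooth_fun f -> (forall i p, partial i f p = 0) ->
  forall p q, f p = f q.
Proof.
move=> Hf f0.
have shift1 p i (s : R) : f (s *: delta_mx 0 i + p) = f p.
  have := @is_derive_0_is_cst R (fun s => f (s *: delta_mx 0 i + p)) s 0.
  rewrite scale0r add0r; apply => x; rewrite -(f0 i (x *: delta_mx 0 i + p)).
  apply: is_derive_along; exact: Ck_derivable (Hf 1%N).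
suff all0 p : f p = f 0 by move=> p q; rewrite all0 -(all0 q).
rewrite [p]row_sum_delta.
elim: (index_enum _) => [|i s IH]; first by rewrite big_nil.
by rewrite big_cons shift1.
Qed.

Lemma smooth_affine n' (b : 'rV[R]_n') (L : 'M[R]_(n, n')) :
  smooth_map (fun p => b + p *m L).
Proof.
move=> r j; have : smooth_fun (fun p => b 0 j + \sum_i p 0 i * L i j).
  apply: smooth_add; first exact: smooth_cst.
  apply: smooth_sum => i; apply: smooth_mul; first exact: smooth_coord.
  exact: smooth_cst.
move=> /(_ r); congr Ck; apply/funext => p.
by rewrite !mxE.
Qed.


Lemma derive1_row (c d : R -> 'rV[R]_n) :
  (forall s (m : 'I_n), is_derive s (1 : R) (fun s => c s 0 m) (d s 0 m)) ->
  (forall s, derivable c s 1) /\ derive1 c = d.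
Proof.
move=> H.
have dc s : derivable c s 1.
  by apply/derivable_mxP => i j; rewrite ord1; have [] := H s j.
split=> //; apply/funext => s; rewrite derive1E derive_mx //.
by apply/rowP => m; rewrite mxE; have [_ ->] := H s m.
Qed.


End PartialDerivatives.

(** * Second derivatives of an isometry of a warped metric *)

Definition warp {R : realType} {n : nat} (al : 'I_n -> R) (m : 'I_n) (u : R) : R :=
  expR (- (2 * al m * u)).

(** The contraction sum_l Gamma^l_(i j) w_l of the Christoffel symbols of the
   metric sum_m g_m dx_m^2, g_m = exp(-2 al_m x_U), with a covector w. *)
Definition christoffel_form {R : realType} {n : nat} (al : 'I_n -> R) (U : 'I_n)
    (g : 'I_n -> R) (i j : 'I_n) (w : 'I_n -> R) : R :=
  - (al j * (i == U)%:R * w j) - al i * (j == U)%:R * w i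
  + (i == j)%:R * (al i * g i) * w U.

Lemma christoffel_form_comb (R : realType) (n : nat) (al : 'I_n -> R) U g i j
    (u c : 'I_n -> R) (v : 'I_n -> 'I_n -> R) :
  christoffel_form al U g i j (fun l => u l + \sum_m c m * v m l)
  = christoffel_form al U g i j u + \sum_m c m * christoffel_form al U g i j (v m).
Proof.
pose A := al j * (i == U)%:R; pose B := al i * (j == U)%:R.
pose C := (i == j)%:R * (al i * g i).
rewrite (eq_bigr (fun m => - (A * (c m * v m j)) - B * (c m * v m i)
    + C * (c m * v m U))); last by move=> m _; rewrite /christoffel_form /A /B /C; ring.
rewrite !big_split /= !sumrN -!mulr_sumr /christoffel_form -/A -/B -/C; ring.
Qed.

(** The chain of identities behind the transformation law of the Christoffel
   symbols only concerns the values at one point, so it is carried out on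
   arrays of numbers: d i m and h i j m stand for the first and second
   derivatives of the m-th coordinate of an isometry, g and e for the diagonal
   entries of the metric at the point and at its image. *)
Section HessianAlgebra.
Set Implicit Arguments.
Unset Strict Implicit.
Variables (R : realType) (n : nat) (al : 'I_n -> R) (U : 'I_n).
Variables (e g : 'I_n -> R) (d : 'I_n -> 'I_n -> R) (h : 'I_n -> 'I_n -> 'I_n -> R).
Implicit Types i j l m : 'I_n.
Hypothesis e_gt0 : forall m, 0 < e m.
Hypothesis g_gt0 : forall m, 0 < g m.
Hypothesis gU : g U = 1.
Hypothesis iso_d : forall i j, \sum_m e m * d i m * d j m = (i == j)%:R * g i.
Hypothesis hC : forall i j m, h i j m = h j i m.

(** Up to sign, the pull-back of the second fundamental form of the level sets
   of the height. *)
Definition shape i j : R := \sum_m al m * (e m * d i m * d j m).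

Lemma shapeC i j : shape i j = shape j i.
Proof. by apply: eq_bigr => m _; rewrite mulrAC. Qed.

Let S i j l := \sum_m e m * h i j m * d l m.

Hypothesis iso_h : forall l i j, S l i j + S l j i - 2 * d l U * shape i j
  = - (2 * (i == j)%:R * al i * (U == l)%:R * g i).

Let SC i j l : S i j l = S j i l.
Proof. by apply: eq_bigr => m _; rewrite hC. Qed.

(** Koszul's trick: the alternating sum of the three cyclic forms of the
   differentiated isometry equation isolates S i j l. *)
Let koszul i j l :
  S i j l = d i U * shape j l + d j U * shape i l - d l U * shape i j
    + (- ((j == l)%:R * al j * (U == i)%:R * g j)
       - (i == l)%:R * al i * (U == j)%:R * g i
       + (i == j)%:R * al i * (U == l)%:R * g i).
Proof.
have := iso_h i j l; have := iso_h j i l; have := iso_h l i j.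
rewrite (SC j i l) (SC l i j) (SC l j i).
move: (S i j l) (S i l j) (S j l i) (shape j l) (shape i l) (shape i j).
move=> x1 x2 x3 x4 x5 x6.
move: ((j == l)%:R) ((i == l)%:R) ((i == j)%:R) => b1 b2 b3 E1 E2 E3.
apply: (@mulfI _ 2) => //.
transitivity ((x1 + x2 - 2 * d i U * x4) + (x1 + x3 - 2 * d j U * x5)
  - (x2 + x3 - 2 * d l U * x6) + 2 * (d i U * x4 + d j U * x5 - d l U * x6)).
  by ring.
by rewrite E1 E2 E3; ring.
Qed.

(** The isometry equation says that diag(g)^-1 D diag(e) is a left inverse of
   the transpose of the Jacobian matrix D; for square matrices it is then also
   a right inverse. *)
Lemma iso_dual m m' :
  \sum_i (g i)^-1 * d i m * d i m' = (m == m')%:R * (e m)^-1.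
Proof.
pose D := \matrix_(i, s) d i s.
pose G := diag_mx (\row_s e s).
pose H := diag_mx (\row_s (g s)^-1).
have HD : H *m D *m G *m D^T = 1%:M.
  rewrite -mulmxA -mulmxA /H mul_diag_mx; apply/matrixP => i j; rewrite !mxE.
  rewrite (_ : \sum_m _ = \sum_m e m * d i m * d j m); last first.
    by apply: eq_bigr => s _; rewrite /G mul_diag_mx !mxE mulrCA mulrA.
  rewrite iso_d; have [->|_] := eqVneq i j; last by rewrite mul0r mulr0.
  by rewrite mul1r mulVf // gt_eqF.
have := mulmx1C HD => /matrixP /(_ m m'); rewrite mxE [RHS]mxE.
rewrite (_ : \sum_j _ = (\sum_i (g i)^-1 * d i m * d i m') * e m'); last first.
  rewrite mulr_suml; apply: eq_bigr => i _.
  by rewrite /G mul_mx_diag [X in _ * X]mxE /H mul_diag_mx !mxE; ring.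
move/(canRL (mulfK (lt0r_neq0 (e_gt0 m')))) => ->.
by case: eqVneq => [->|] //=; rewrite !mul0r.
Qed.

(** Transformation law of the Christoffel symbols.  [koszul] gives the second
   derivatives paired with every column of the Jacobian; contracting with the
   dual frame [c] of [iso_dual] isolates the m-th coordinate. *)
Lemma isometry_second_derivative i j m :
  e m * h i j m
  = christoffel_form al U g i j (fun l => e m * d l m)
    + al m * (d i U * (e m * d j m) + d j U * (e m * d i m))
    - (m == U)%:R * shape i j.
Proof.
pose c l := (g l)^-1 * (e m * d l m).
have cE s : \sum_l c l * d l s = (s == m)%:R.
  transitivity (e m * \sum_i (g i)^-1 * d i m * d i s).
    by rewrite mulr_sumr; apply: eq_bigr => l _; rewrite /c; ring.
  by rewrite iso_dual eq_sym mulrCA mulfV ?mulr1 // gt_eqF.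
have pick (f : 'I_n -> R) : \sum_s f s * (s == m)%:R = f m.
  rewrite (bigD1 m) //= eqxx mulr1 big1 ?addr0 // => s /negPf ->.
  by rewrite mulr0.
have S1 : \sum_l c l * S i j l = e m * h i j m.
  rewrite -(pick (fun s => e s * h i j s)); under [RHS]eq_bigr do rewrite -cE mulr_sumr.
  rewrite exchange_big /=; apply: eq_bigr => s _; rewrite mulr_sumr.
  by apply: eq_bigr => l _; ring.
have Q1 i' : \sum_l c l * shape i' l = al m * (e m * d i' m).
  rewrite -(pick (fun s => al s * (e s * d i' s))).
  under [RHS]eq_bigr do rewrite -cE mulr_sumr.
  rewrite exchange_big /=; apply: eq_bigr => s _; rewrite mulr_sumr.
  by apply: eq_bigr => l _; ring.
have D1 i' : \sum_l c l * ((i' == l)%:R * g i') = e m * d i' m.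
  rewrite (bigD1 i') //= eqxx mul1r big1 ?addr0 => [|l li']; last first.
    by rewrite eq_sym (negPf li') mul0r mulr0.
  by rewrite /c mulrAC mulVf ?mul1r // gt_eqF.
rewrite -S1; under eq_bigr do rewrite koszul.
transitivity (d i U * (\sum_l c l * shape j l)
  + d j U * (\sum_l c l * shape i l)
  - shape i j * (\sum_l c l * d l U)
  - al j * (U == i)%:R * (\sum_l c l * ((j == l)%:R * g j))
  - al i * (U == j)%:R * (\sum_l c l * ((i == l)%:R * g i))
  + (i == j)%:R * al i * g i * (\sum_l c l * ((U == l)%:R * g U))).
  rewrite !mulr_sumr -!sumrN -!big_split /=; apply: eq_bigr => l _.
  by rewrite gU //; ring.
rewrite !Q1 !D1 cE /christoffel_form ![U == _]eq_sym; ring.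
Qed.

End HessianAlgebra.

(** * Killing covectors of a warped metric *)

Section KillingFields.
Set Implicit Arguments.
Unset Strict Implicit.
Variables (R : realType) (n : nat) (al : 'I_n -> R) (U : 'I_n).
Hypothesis alU : al U = 0.
Local Notation V := 'rV[R]_n.
Local Notation warp := (warp al).
Implicit Types (p q : V) (i j l m : 'I_n) (w : 'I_n -> V -> R).

Lemma warpU u : warp U u = 1.
Proof. by rewrite /warp alU mulr0 mul0r oppr0 expR0. Qed.

Lemma warp_gt0 m u : 0 < warp m u.
Proof. exact: expR_gt0. Qed.

Lemma smooth_warp m (f : V -> R) : smooth_fun f -> smooth_fun (fun q => warp m (f q)).
Proof.
move=> Hf; rewrite /warp; apply: smooth_exp.
under eq_fun do rewrite -mulNr.
by apply: smooth_mul => //; exact: smooth_cst.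
Qed.

Lemma partial_warp i m (f : V -> R) p : smooth_fun f ->
  partial i (fun q => warp m (f q)) p = - (2 * al m * partial i f p) * warp m (f p).
Proof.
move=> Hf; rewrite /warp partial_exp; last first.
  by under eq_fun do rewrite -mulNr; apply: smooth_mul => //; exact: smooth_cst.
under eq_fun do rewrite -mulNr.
by rewrite partial_scale // mulNr.
Qed.

(** The Killing equation for the 1-form metrically dual to a vector field. *)
Definition killing w : Prop := forall i j p,
  partial i (w j) p + partial j (w i) p
  = 2 * christoffel_form al U (fun m => warp m (p 0 U)) i j (fun m => w m p).

(** The equation in the directions (U, U) makes w_U independent of x_U.  For l
   and m with al_l <> al_m, differentiating the (l, m) equation along U gives
   d_l d_m w_U = (al_l - al_m) d_l w_m; as the left-hand side does not depend on
   x_U, a second differentiation leaves (al_l + al_m) d_l w_m = 0.  Finally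
   d_l of the (m, m) equation becomes d_l w_U = 0. *)
Lemma killing_vertical_cst w : killing w -> (forall i, smooth_fun (w i)) ->
  (forall m, m != U -> 0 < al m) ->
  (forall m, m != U -> exists2 m', m' != U & al m' != al m) ->
  forall p q, w U p = w U q.
Proof.
move=> K sw al_gt0 al_ne.
have C2 i j f : smooth_fun f -> partial i (partial j f) = partial j (partial i f).
  by move=> Hf; exact: partialC (Hf 2%N).
have KUU p : partial U (w U) p = 0.
  have := K U U p; rewrite /christoffel_form alU eqxx /=; lra.
have KU m : m != U ->
    partial U (w m) = fun p => - (2 * al m) * w m p + -1 * partial m (w U) p.
  move=> mU; apply/funext => p.
  have := K U m p.
  by rewrite /christoffel_form alU eqxx (negPf mU) eq_sym (negPf mU) /=; lra.
have Kd m : m != U -> partial m (w m) = fun p => al m * (warp m (p 0 U) * w U p).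
  move=> mU; apply/funext => p.
  have := K m m p; rewrite /christoffel_form eqxx (negPf mU) /=; lra.
have Ko m m' : m != U -> m' != U -> m != m' ->
    partial m (w m') = fun p => -1 * partial m' (w m) p.
  move=> mU m'U mm'; apply/funext => p.
  have := K m m' p; rewrite /christoffel_form (negPf mm') (negPf mU) (negPf m'U) /=; lra.
have sp i j : smooth_fun (partial i (w j)) by exact: smooth_fun_partial.
have spp i j l : smooth_fun (partial l (partial i (w j))) by exact: smooth_fun_partial.
have ssc c f : smooth_fun f -> smooth_fun (fun q : V => c * f q).
  by move=> Hf; apply: smooth_mul => //; exact: smooth_cst.
have dUA m l p : m != U -> partial U (partial l (w m)) p
    = - (2 * al m) * partial l (w m) p - partial l (partial m (w U)) p.
  move=> mU; rewrite C2 // KU // partial_add; [|exact: ssc|exact: ssc].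
  by rewrite !partial_scale // mulN1r.
apply: partial0_cst => // l p.
have [->|lU] := eqVneq l U; first exact: KUU.
have [m mU alm] := al_ne l lU.
have ml : l != m by apply: contraNneq alm => ->.
(* [dUA] for w_m and for w_l, added: d_m w_l = - d_l w_m *)
have gE q : partial l (partial m (w U)) q = (al l - al m) * partial l (w m) q.
  have E1 := dUA m l q mU; have E2 := dUA l m q lU.
  have ml' : m != l by rewrite eq_sym.
  rewrite (Ko m l) // partial_scale // in E2.
  rewrite [partial m (partial l _)]C2 // in E2.
  by move: E1 E2; set x := partial U _ _; set y := partial l (w m) q; lra.
have A0 q : partial l (w m) q = 0.
  have E1 := dUA m l q mU; rewrite gE in E1.
  have : partial U (partial l (partial m (w U))) q = 0.
    rewrite C2 // [partial U (partial m _)]C2 //.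
    rewrite (_ : partial U (w U) = fun=> 0); last by apply/funext => x; exact: KUU.
    rewrite (_ : partial m (fun=> 0) = fun=> 0) ?partial_cst //.
    by apply/funext => x; exact: partial_cst.
  rewrite (_ : partial l (partial m (w U)) = fun q => (al l - al m) * partial l (w m) q);
    last by apply/funext => x; exact: gE.
  rewrite partial_scale // => /eqP; rewrite mulf_eq0 subr_eq0 eq_sym (negPf alm) /=.
  move=> /eqP E2; rewrite E2 in E1.
  have := al_gt0 m mU; have := al_gt0 l lU => l0 m0.
  have : (al m + al l) * partial l (w m) q = 0 by lra.
  by move/eqP; rewrite mulf_eq0 gt_eqF ?addr_gt0 //= => /eqP.
have : partial m (partial l (w m)) p = 0.
  rewrite (_ : partial l (w m) = fun=> 0) ?partial_cst //.
  by apply/funext => x; exact: A0.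
have sU : smooth_fun (fun q : V => q 0 U) by exact: smooth_coord.
rewrite C2 // Kd // partial_scale; last by apply: smooth_mul => //; exact: smooth_warp.
rewrite partial_mul //; last exact: smooth_warp.
rewrite partial_warp // partial_coord eq_sym (negPf lU) !mulr0 oppr0 !mul0r add0r.
move/eqP; rewrite !mulf_eq0 gt_eqF ?al_gt0 //= gt_eqF ?warp_gt0 //=.
by move/eqP.
Qed.

End KillingFields.

(** * Isometries preserve the height up to sign and translation *)

Section IsometryRigidity.
Set Implicit Arguments.
Unset Strict Implicit.
Variables (R : realType) (n : nat) (al : 'I_n -> R) (U : 'I_n).
Hypothesis alU : al U = 0.
Local Notation V := 'rV[R]_n.
Implicit Types (p q : V) (i j l m : 'I_n).
Local Notation warp := (warp al).

Variable F : 'I_n -> V -> R.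
Hypothesis sF : forall m, smooth_fun (F m).
Hypothesis isoF : forall i j p,
  \sum_m warp m (F U p) * partial i (F m) p * partial j (F m) p
  = (i == j)%:R * warp i (p 0 U).

Let hC i j m : partial i (partial j (F m)) = partial j (partial i (F m)).
Proof. exact: partialC (sF m 2%N). Qed.

Let e p m := warp m (F U p).
Let g p m := warp m (p 0 U).
Let d p i m := partial i (F m) p.
Let h p i j m := partial i (partial j (F m)) p.
Let Q i j p := shape al (e p) (d p) i j.
(** The pull-back by F of the covector dual to the translation field along x_m. *)
Let mom m i p := e p m * d p i m.

Let sw m : smooth_fun (fun q => e q m).
Proof. exact: smooth_warp. Qed.

Let sd i m : smooth_fun (fun q => d q i m).
Proof. exact: smooth_fun_partial. Qed.

Let pe l m p : partial l (fun q => e q m) p = - (2 * al m * d p l U) * e p m.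
Proof. exact: partial_warp. Qed.

Let pd l i m p : partial l (fun q => d q i m) p = h p l i m.
Proof. by []. Qed.

Lemma iso_partial p l i j :
  (\sum_m e p m * h p l i m * d p j m) + (\sum_m e p m * h p l j m * d p i m)
  - 2 * d p l U * shape al (e p) (d p) i j
  = - (2 * (i == j)%:R * al i * (U == l)%:R * g p i).
Proof.
have H : partial l (fun q => \sum_m e q m * d q i m * d q j m) p
       = partial l (fun q => (i == j)%:R * warp i (q 0 U)) p.
  by congr (partial l _ p); apply/funext => q; exact: isoF.
transitivity ((i == j)%:R * (- (2 * al i * (U == l)%:R) * g p i)); last by ring.
move: H; rewrite partial_scale; last by apply: smooth_warp; exact: smooth_coord.
rewrite partial_warp; last exact: smooth_coord.
rewrite partial_coord => <-.
rewrite partial_sum; last by move=> m; do 2! apply: smooth_mul => //.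
rewrite /shape mulr_sumr -sumrN -!big_split /=; apply: eq_bigr => m _.
rewrite (partial_mul l p (smooth_mul (sw m) (sd i m)) (sd j m)).
rewrite (partial_mul l p (sw m) (sd i m)) pe !pd.
move: (e p) (d p) (h p) => e' d' h'; ring.
Qed.

Let hess i j m p := @isometry_second_derivative R n al U (e p) (g p) (d p) (h p)
  (fun m => warp_gt0 al m (F U p)) (fun m => warp_gt0 al m (p 0 U)) (warpU alU (p 0 U))
  (fun i j => isoF i j p) (fun i j m => congr1 (fun f => f p) (hC i j m))
  (iso_partial p) i j m.

(** The Killing operator applied to [mom m]; the defect for m = U reflects that
   the translation along the height is not an isometry. *)
Lemma sym_partial_mom m i j p :
  partial i (mom m j) p + partial j (mom m i) p
  = 2 * christoffel_form al U (g p) i j (fun l => mom m l p) - 2 * (m == U)%:R * Q i j p.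
Proof.
rewrite /mom (partial_mul i p (sw m) (sd j m)) (partial_mul j p (sw m) (sd i m)).
rewrite !pe !pd; have E := hess i j m p.
have E2 : h p j i m = h p i j m by rewrite /h hC.
rewrite E2.
transitivity (2 * (e p m * h p i j m)
   - 2 * al m * (d p i U * (e p m * d p j m) + d p j U * (e p m * d p i m))).
  by move: (e p) (d p) (h p) => e' d' h'; ring.
rewrite E /Q; move: (christoffel_form _ _ _ _ _ _) (shape _ _ _ _ _) => x y.
by move: (e p) (d p) => e' d'; ring.
Qed.

Lemma smooth_mom m i : smooth_fun (mom m i).
Proof. by apply: smooth_mul; [exact: smooth_warp|exact: smooth_fun_partial]. Qed.

Lemma killing_mom m : m != U -> killing al U (mom m).
Proof. by move=> mU i j p; rewrite sym_partial_mom (negPf mU) mulr0 mul0r subr0. Qed.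

(** The pull-back of the covector dual to the field d_U + sum_m al_m x_m d_m,
   which generates the left translations along the height. *)
Let dilcov i p := mom U i p + \sum_m (al m * F m p) * mom m i p.

Let scF m : smooth_fun (fun q => al m * F m q).
Proof. by apply: smooth_mul => //; exact: smooth_cst. Qed.

Lemma smooth_dilcov i : smooth_fun (dilcov i).
Proof.
apply: smooth_add; first exact: smooth_mom.
by apply: smooth_sum => m; apply: smooth_mul => //; exact: smooth_mom.
Qed.

(** The term sum_m al_m dF_m (x) mom m that arises from the coefficients al_m F_m
   is [shape], and cancels the defect of [mom U] in [sym_partial_mom]. *)
Lemma killing_dilcov : killing al U dilcov.
Proof.
move=> i j p.
have pdil i' j' : partial i' (dilcov j') p = partial i' (mom U j') p
    + Q i' j' p + \sum_m al m * F m p * partial i' (mom m j') p.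
  rewrite /dilcov (partial_add i' p (smooth_mom U j')
    (smooth_sum _ (fun m => smooth_mul (scF m) (smooth_mom m j')))).
  rewrite (partial_sum i' _ p (fun m => smooth_mul (scF m) (smooth_mom m j'))).
  rewrite -addrA; congr (_ + _); rewrite -big_split /=; apply: eq_bigr => m _.
  rewrite (partial_mul i' p (scF m) (smooth_mom m j')) (partial_scale i' _ p (sF m)).
  by congr (_ + _); rewrite -mulrA; congr (_ * _); rewrite /mom mulrCA mulrA.
rewrite !pdil (@christoffel_form_comb R n al U (g p) i j (fun l => mom U l p)
  (fun m => al m * F m p) (fun m l => mom m l p)) mulrDr.
have -> : Q j i p = Q i j p by exact: shapeC.
transitivity ((partial i (mom U j) p + partial j (mom U i) p) + 2 * Q i j p
  + \sum_m al m * F m p * (partial i (mom m j) p + partial j (mom m i) p)).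
  under [in RHS]eq_bigr do rewrite mulrDr.
  rewrite big_split /=.
  by rewrite addrACA [X in X + _ = _]addrACA [2 * Q i j p]mulr_natl mulr2n.
congr (_ + _).
  by rewrite sym_partial_mom eqxx mulr1 subrK.
rewrite mulr_sumr; apply: eq_bigr => m _; rewrite sym_partial_mom.
have [->|mU] := eqVneq m U; first by rewrite alU !mul0r mulr0.
by rewrite mulr0 mul0r subr0 mulrCA.
Qed.

Hypothesis al_gt0 : forall m, m != U -> 0 < al m.
Hypothesis al_ne : forall m, m != U -> exists2 m', m' != U & al m' != al m.
Hypothesis surjF : forall y : V, exists p, forall m, F m p = y 0 m.

(** By [killing_vertical_cst] the covectors [mom m], m <> U, and [dilcov] have
   constant vertical components c_m and c, so the vertical derivative of F at p
   is a function of the point F p; that it has norm 1 reads as equation [E]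
   below.  As F is onto, [E] holds with arbitrary values of the F_m: along the
   U-axis it forces all c_m = 0 and c^2 = 1, so the vertical derivative of F is
   c d_U.  Pairing with the other columns of the Jacobian gives dF_U = c dx_U. *)
Lemma iso_height : exists c d : R, c ^+ 2 = 1 /\ forall p, F U p = c * p 0 U + d.
Proof.
have momE m : m != U -> forall p, mom m U p = mom m U 0.
  move=> mU p; apply: (killing_vertical_cst alU (killing_mom mU)) => //.
  by move=> i; exact: smooth_mom.
have dilE p : dilcov U p = dilcov U 0.
  apply: (killing_vertical_cst alU killing_dilcov) => //.
  by move=> i; exact: smooth_dilcov.
set c := dilcov U 0 in dilE.
have mUU p : mom U U p = partial U (F U) p by rewrite /mom /e warpU // mul1r.
have E p : (c - \sum_m al m * F m p * mom m U 0) ^+ 2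
    + \sum_(m | m != U) (warp m (F U p))^-1 * (mom m U 0) ^+ 2 = 1.
  have := isoF U U p; rewrite (bigD1 U) //= eqxx !warpU // mulr1 mul1r => H.
  rewrite -[RHS]H; clear H.
  congr (_ + _).
    have -> : c - \sum_m al m * F m p * mom m U 0 = partial U (F U) p.
      rewrite -(dilE p) /dilcov mUU -addrA -[RHS]addr0; congr (_ + _).
      apply/eqP; rewrite subr_eq0; apply/eqP/eq_bigr => m _.
      have [->|mU] := eqVneq m U; first by rewrite alU !mul0r.
      by rewrite (momE m mU p).
    by rewrite expr2.
  apply: eq_bigr => m mU; rewrite -(momE m mU p) /mom /e /d.
  by have := warp_gt0 al m (F U p); move=> /lt0r_neq0 ?; field.
have mom0 m : m != U -> mom m U 0 = 0.
  move=> mU.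
  have Es (s : R) : c ^+ 2 + \sum_(m | m != U) expR (2 * al m * s) * (mom m U 0) ^+ 2 = 1.
    have [p pE] := surjF (s *: delta_mx 0 U).
    have Z : \sum_m al m * F m p * mom m U 0 = 0.
      rewrite big1 // => l _; rewrite pE !mxE eqxx /=.
      have [->|_] := eqVneq l U; first by rewrite alU !mul0r.
      by rewrite mulr0 mulr0 mul0r.
    rewrite -[RHS](E p) Z subr0; congr (_ + _); apply: eq_bigr => l _.
    by rewrite pE !mxE !eqxx mulr1 /warp expRN invrK.
  have : \sum_(m | m != U) (expR (2 * al m * 1) - 1) * (mom m U 0) ^+ 2 = 0.
    under eq_bigr do rewrite mulrBl mul1r.
    rewrite big_split /= sumrN.
    have := Es 0; have := Es 1.
    under [in X in _ -> X -> _]eq_bigr do rewrite mulr0 expR0 mul1r.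
    by lra.
  move/eqP; rewrite psumr_eq0 => [/allP /(_ m)|l lU]; last first.
    rewrite mulr_ge0 ?sqr_ge0 // subr_ge0 mulr1 -[X in X <= _]expR0 ler_expR mulr_ge0 //.
    by rewrite ltW // al_gt0.
  rewrite mem_index_enum mU => /(_ isT) /=; rewrite mulf_eq0 sqrf_eq0.
  case/orP => [|/eqP //].
  rewrite subr_eq0 mulr1 => /eqP; rewrite -[X in _ = X]expR0 => /expR_inj.
  by have := al_gt0 mU; lra.
have dU0 m p : m != U -> partial U (F m) p = 0.
  move=> mU; have := momE m mU p; rewrite mom0 // /mom /e /d => /eqP.
  by rewrite mulf_eq0 gt_eqF ?warp_gt0 //= => /eqP.
have dUU p : partial U (F U) p = c.
  rewrite -(dilE p) /dilcov mUU big1 ?addr0 // => m _.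
  have [->|mU] := eqVneq m U; first by rewrite alU !mul0r.
  by rewrite /mom /d dU0 ?mulr0.
have c2 : c ^+ 2 = 1.
  have := isoF U U 0; rewrite (bigD1 U) //= eqxx !warpU // dUU mulr1 mul1r.
  rewrite big1 ?addr0 => [|m mU]; last by rewrite dU0 // mulr0.
  by rewrite expr2.
have dj j p : partial j (F U) p = c * (j == U)%:R.
  have := isoF U j p; rewrite (bigD1 U) //= !warpU // dUU mul1r mulr1.
  rewrite big1 ?addr0 => [H|m mU]; last by rewrite dU0 // mulr0 mul0r.
  by rewrite [j == U]eq_sym -H mulrA -expr2 c2 mul1r.
have sp : smooth_fun (fun q : V => - c * q 0 U).
  by apply: smooth_mul; [exact: smooth_cst|exact: smooth_coord].
pose D (p : V) := F U p + - c * p 0 U.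
have D0 : forall p q, D p = D q.
  apply: partial0_cst; first exact: smooth_add.
  move=> i p; rewrite /D partial_add // partial_scale; last exact: smooth_coord.
  by rewrite partial_coord dj eq_sym; ring.
exists c, (D 0); split=> // p; rewrite -(D0 p) /D; ring.
Qed.

End IsometryRigidity.

(** * The group S H acts by isometries *)

Section BlockDiagonal.
Set Implicit Arguments.
Unset Strict Implicit.
Variables (R : realType) (l : nat) (ks : 'I_l -> nat).
Local Notation k := (\sum_(j < l) ks j)%N.
Implicit Types (h : 'M[R]_k) (i j : 'I_k) (q r : 'I_l).

Lemma mem_block_sig1 i : i \in block ks (tagnat.sig1 i).
Proof.
rewrite inE; set s := (\sum_(j < l | j < tagnat.sig1 i) ks j)%N.
have iE : nat_of_ord i = (s + tagnat.sig2 i)%N by exact: tagnat.rect.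
have -> : (\sum_(j < l | j <= tagnat.sig1 i) ks j = s + ks (tagnat.sig1 i))%N.
  rewrite (bigD1 (tagnat.sig1 i)) //= addnC; congr (_ + _)%N.
  by apply: eq_bigl => j; rewrite /= ltn_neqAle andbC.
by rewrite iE leq_addr ltn_add2l ltn_ord.
Qed.

Lemma mxdiag_off (B : forall q, 'M[R]_(ks q)) i j :
  tagnat.sig1 i != tagnat.sig1 j -> (\mxdiag_q B q) i j = 0.
Proof. by move=> ij; rewrite !mxE (negPf ij) mxE. Qed.

Lemma mul_mxdiag (A B : forall q, 'M[R]_(ks q)) :
  \mxdiag_q A q *m \mxdiag_q B q = \mxdiag_q (A q *m B q).
Proof.
rewrite [X in _ *m X]/mxdiag mul_mxdiag_mxblock; apply/eq_mxblock => i j.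
by case: eqVneq => [->|_]; rewrite ?conform_mx_id ?mulmx0.
Qed.

Lemma prod_SO1 : prod_SO R l ks 1%:M.
Proof.
exists (fun q => 1%:M); last exact: mxdiagZ.
by move=> q /=; rewrite /SO /= trmx1 mulmx1 det1.
Qed.

Lemma prod_SO_mul h h' : prod_SO R l ks h -> prod_SO R l ks h' ->
  prod_SO R l ks (h *m h').
Proof.
move=> [A HA <-] [B HB <-]; exists (fun q => A q *m B q); last by rewrite mul_mxdiag.
move=> q /=; rewrite /SO /=; have [A1 A2] := HA q; have [B1 B2] := HB q.
rewrite det_mulmx A2 B2 mulr1 trmx_mul; split=> //.
by rewrite -mulmxA (mulmxA (B q)) B1 mul1mx.
Qed.

Lemma prod_SO_tr h : prod_SO R l ks h -> prod_SO R l ks h^T.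
Proof.
move=> [A HA <-]; exists (fun q => (A q)^T); last by rewrite tr_mxdiag.
move=> q /=; rewrite /SO /=; have [A1 A2] := HA q.
by rewrite det_tr trmxK; split=> //; exact: mulmx1C.
Qed.

Lemma prod_SO_orthogonal h : prod_SO R l ks h -> h *m h^T = 1%:M.
Proof.
move=> [A HA <-]; rewrite tr_mxdiag mul_mxdiag -mxdiagZ; apply: eq_mxdiag => q.
by have [] := HA q.
Qed.

Lemma prod_SO_orthogonalC h : prod_SO R l ks h -> h^T *m h = 1%:M.
Proof. by move=> /prod_SO_orthogonal /mulmx1C. Qed.

(** Entries of [h] outside the diagonal blocks vanish, and the diagonal matrix is
   constant on each block. *)
Lemma prod_SO_expA (a : 'rV[R]_k) h u :
  (forall q i j, i \in block ks q -> j \in block ks q -> a 0 i = a 0 j) ->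
  prod_SO R l ks h -> h *m expA a u = expA a u *m h.
Proof.
move=> a_block [A HA <-]; rewrite /expA; set d := \row_i _.
have dE i : d 0 i = expR (u * a 0 i) by rewrite mxE.
rewrite mul_mx_diag mul_diag_mx; apply/matrixP => i j.
rewrite [LHS]mxE [RHS]mxE !dE.
have [ij|/mxdiag_off ->] := eqVneq (tagnat.sig1 i) (tagnat.sig1 j); last first.
  by rewrite mul0r mulr0.
rewrite mulrC (a_block (tagnat.sig1 i) i j) ?mem_block_sig1 //.
by rewrite ij mem_block_sig1.
Qed.

End BlockDiagonal.

Section GroupSH.
Set Implicit Arguments.
Unset Strict Implicit.
Variables (R : realType) (l : nat) (ks : 'I_l -> nat).
Local Notation k := (\sum_(j < l) ks j)%N.
Variable a : 'rV[R]_k.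
Hypothesis a_block : forall q i j, i \in block ks q -> j \in block ks q ->
  a 0 i = a 0 j.
Implicit Types (z : SH_type R k) (p v w : 'rV[R]_(k + 1)).

Lemma SH_actE z p : SH_act a z p =
  mkS (z.2 + e_part p *m z.1.1^T *m expA a z.1.2) (z.1.2 + f_part p).
Proof. by rewrite /SH_act /S_mul /h_act !e_part_mkS !f_part_mkS. Qed.

Lemma SH_act_one z : SH_act a z (S_one R k) = mkS z.2 z.1.2.
Proof.
have e0 : e_part (S_one R k) = 0 by rewrite /e_part /S_one linear0.
have f0 : f_part (S_one R k) = 0 by rewrite /f_part !mxE.
by rewrite SH_actE e0 f0 !mul0mx !addr0.
Qed.

Lemma mkS_inj x x' (u u' : R) : mkS x u = mkS x' u' :> 'rV_(k + 1) -> x = x' /\ u = u'.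
Proof.
move=> E; split; first by rewrite -(e_part_mkS x u) E e_part_mkS.
by rewrite -(f_part_mkS x u) E f_part_mkS.
Qed.

Lemma SH_closed z z' : SH R l ks z -> SH R l ks z' -> SH R l ks (SH_mul a z z').
Proof. exact: prod_SO_mul. Qed.

Lemma SH_act_mul z z' : SH R l ks z -> SH R l ks z' ->
  SH_act a (SH_mul a z z') = SH_act a z \o SH_act a z'.
Proof.
move=> Hz Hz'; apply/funext => p; rewrite /= !SH_actE !(e_part_mkS, f_part_mkS) /=.
congr mkS; last by rewrite addrA.
rewrite !mulmxDl -addrA; congr (_ + (_ + _)).
have E := prod_SO_expA z'.1.2 a_block (prod_SO_tr Hz).
rewrite trmx_mul expAD -!mulmxA; congr (_ *m (_ *m _)).
by rewrite [RHS]mulmxA -E -mulmxA -!expAD addrC.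
Qed.

Definition SH_linear z : 'M[R]_(k + 1) := block_mx (z.1.1^T *m expA a z.1.2) 0 0 1%:M.

Lemma mkS_linear z x u : mkS x u *m SH_linear z = mkS (x *m z.1.1^T *m expA a z.1.2) u.
Proof.
by rewrite /mkS /SH_linear mul_row_block !mulmx0 addr0 add0r mulmx1 mulmxA.
Qed.

Lemma SH_act_affine z : SH_act a z = fun p => mkS z.2 z.1.2 + p *m SH_linear z.
Proof.
apply/funext => p; rewrite SH_actE -{3}(mkS_parts p) mkS_linear.
by rewrite /mkS add_row_mx -raddfD.
Qed.

Lemma rho_matrix p v w : rho a p v w =
  (e_part v *m expA a (- (2 * f_part p)) *m (e_part w)^T) 0 0 + f_part v * f_part w.
Proof.
rewrite rhoE; congr (_ + _); rewrite mxE; apply: eq_bigr => i _.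
have -> : (e_part v *m expA a (- (2 * f_part p))) 0 i
        = e_part v 0 i * expR (- (2 * f_part p * a 0 i)).
  rewrite /expA; set d := \row_i _.
  have dE : d 0 i = expR (- (2 * f_part p * a 0 i)) by rewrite mxE mulNr.
  by rewrite mul_mx_diag -dE mxE.
have -> : (e_part w)^T i 0 = e_part w 0 i by rewrite mxE.
by rewrite [expR _ * _]mulrC.
Qed.

(** The factors exp(u A_1) of the linear part of the action compensate the shift
   of the height in the weights of the metric; the rotation then cancels
   because it commutes with the weights. *)
Lemma rho_SH_act z p v w : SH R l ks z ->
  rho a (SH_act a z p) ('D_v (SH_act a z) p) ('D_w (SH_act a z) p) = rho a p v w.
Proof.
move=> Hz.
have D y : 'D_y (SH_act a z) p = y *m SH_linear z.
  by rewrite SH_act_affine derive_affine.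
rewrite !D -{1}(mkS_parts v) -{1}(mkS_parts w) !mkS_linear !rho_matrix SH_actE.
rewrite !e_part_mkS !f_part_mkS; congr (_ 0 0 + _).
rewrite !trmx_mul trmxK (_ : (expA a z.1.2)^T = expA a z.1.2); last exact: tr_diag_mx.
rewrite -!mulmxA; congr (_ *m _).
have EE : expA a z.1.2 *m expA a (- (2 * (z.1.2 + f_part p))) *m expA a z.1.2
        = expA a (- (2 * f_part p)).
  by rewrite -!expAD; congr expA; ring.
rewrite (mulmxA (expA a z.1.2) (expA a _)).
rewrite (mulmxA (expA a z.1.2 *m _) (expA a z.1.2)) EE.
rewrite (mulmxA z.1.1^T) (prod_SO_expA _ a_block (prod_SO_tr Hz)) -mulmxA.
by rewrite (mulmxA z.1.1^T) (prod_SO_orthogonalC Hz) mul1mx.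
Qed.

Definition SH_inv z : SH_type R k :=
  (z.1.1^T, - z.1.2, - (z.2 *m z.1.1 *m expA a (- z.1.2))).

Lemma SH_act1 p : SH_act a (1%:M, 0, 0) p = p.
Proof. by rewrite SH_actE /= trmx1 mulmx1 expA0 mulmx1 !add0r mkS_parts. Qed.

Lemma SH_actV z : SH R l ks z -> cancel (SH_act a z) (SH_act a (SH_inv z)).
Proof.
move=> Hz p; have Hv : SH R l ks (SH_inv z) by exact: prod_SO_tr Hz.
rewrite -[LHS]/((SH_act a (SH_inv z) \o SH_act a z) p) -SH_act_mul //.
rewrite -[RHS]SH_act1; congr (SH_act a _ p); rewrite /SH_mul /SH_inv /=.
by rewrite (prod_SO_orthogonalC Hz) addNr trmxK addNr.
Qed.

Lemma SH_actVr z : SH R l ks z -> cancel (SH_act a (SH_inv z)) (SH_act a z).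
Proof.
move=> Hz p; have Hv : SH R l ks (SH_inv z) by exact: prod_SO_tr Hz.
rewrite -[LHS]/((SH_act a z \o SH_act a (SH_inv z)) p) -SH_act_mul //.
rewrite -[RHS]SH_act1; congr (SH_act a _ p); rewrite /SH_mul /SH_inv /=.
rewrite (prod_SO_orthogonal Hz) subrr !mulNmx -!mulmxA.
rewrite [expA _ _ *m (_ *m _)]mulmxA -(prod_SO_expA _ a_block (prod_SO_tr Hz)).
rewrite -!mulmxA -expAD addNr expA0 mulmx1 (prod_SO_orthogonal Hz) mulmx1 subrr.
by [].
Qed.

Lemma SH_act_isometry z : SH R l ks z -> riemannian_isometry (rho a) (SH_act a z).
Proof.
move=> Hz; split; last by move=> p v w; exact: rho_SH_act.
split; first by rewrite SH_act_affine; exact: smooth_affine.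
exists (SH_act a (SH_inv z)); split.
- by rewrite SH_act_affine; exact: smooth_affine.
- exact: SH_actV.
- exact: SH_actVr.
Qed.

Lemma SH_transitive p : exists2 z, SH R l ks z & SH_act a z (S_one R k) = p.
Proof.
exists (1%:M, f_part p, e_part p); first exact: prod_SO1.
by rewrite SH_act_one mkS_parts.
Qed.

Lemma SH_stabilizer z z' : SH R l ks z -> SH R l ks z' ->
  SH_act a z (S_one R k) = SH_act a z' (S_one R k) <->
  exists2 h, prod_SO R l ks h & z' = SH_mul a z (SH_of_H h).
Proof.
move: z z' => [[h u] x] [[h' u'] x'] Hz Hz'; rewrite !SH_act_one /=.
split=> [/mkS_inj [-> ->]|[h0 _ [_ -> ->]]]; last by rewrite !mul0mx !addr0.
exists (h^T *m h'); first by apply: prod_SO_mul => //; exact: prod_SO_tr.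
by rewrite /SH_mul /= !mul0mx !addr0 mulmxA (prod_SO_orthogonal Hz) mul1mx.
Qed.

End GroupSH.

(** * A geodesic of rho that is not homogeneous *)

Section WarpedGeometry.
Set Implicit Arguments.
Unset Strict Implicit.
Variables (R : realType) (k : nat) (a : 'rV[R]_k).
Local Notation V := 'rV[R]_(k + 1).
Implicit Types (p v w : V) (i j l m : 'I_(k + 1)).

Definition weight m : R := (row_mx a 0 : V) 0 m.
Local Notation al := weight.
Local Notation U := (rshift k (0 : 'I_1)).

Lemma weightl (i : 'I_k) : al (lshift 1 i) = a 0 i.
Proof. by rewrite /weight row_mxEl. Qed.

Lemma weightU : al U = 0.
Proof. by rewrite /weight row_mxEr mxE. Qed.

Lemma rho_warp p v w :
  rho a p v w = \sum_m warp al m (p 0 U) * v 0 m * w 0 m.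
Proof.
rewrite rhoE big_split_ord big_ord1 /= warpU ?weightU // mul1r /f_part !mxE.
congr (_ + _); apply: eq_bigr => i _.
by rewrite /warp weightl /e_part !mxE (mulrAC 2).
Qed.

Lemma rho_delta p i j :
  rho a p (delta_mx 0 i) (delta_mx 0 j) = (i == j)%:R * warp al i (p 0 U).
Proof.
rewrite rho_warp (bigD1 i) //= big1 ?addr0 => [|m mi].
  by rewrite !mxE !eqxx mulr1 mulrC.
by rewrite !mxE eqxx (negPf mi) mulr0 mul0r.
Qed.

Lemma smooth_map_derive (f : V -> V) p i m : smooth_map f ->
  ('D_(delta_mx 0 i) f p) 0 m = partial i (fun q => f q 0 m) p.
Proof.
move=> sf; rewrite derive_mx ?mxE //; apply/derivable_mxP => i' j'.
by rewrite ord1; apply: Ck_derivable (sf 1%N j').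
Qed.

(** [iso_height] for the coordinates of [f]; surjectivity comes from the inverse
   of the diffeomorphism. *)
Lemma isometry_height (f : V -> V) :
  (forall i : 'I_k, 0 < a 0 i) ->
  (forall i : 'I_k, exists j : 'I_k, a 0 j != a 0 i) ->
  riemannian_isometry (rho a) f ->
  exists c d : R, c ^+ 2 = 1 /\ forall p, f p 0 U = c * p 0 U + d.
Proof.
move=> a_gt0 a_ne [[sf [f' [_ _ f'K]]] isof].
have Uleft (P : 'I_(k + 1) -> Prop) :
    (forall i : 'I_k, P (lshift 1 i)) -> forall m, m != U -> P m.
  move=> HP m; rewrite -(splitK m); case: (fintype.split m) => i //=.
  by rewrite ord1 eqxx.
apply: (@iso_height R _ al U weightU (fun m q => f q 0 m)).
- by move=> m r; exact: sf.
- move=> i j p; rewrite -rho_delta -isof rho_warp.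
  apply: eq_bigr => m _.
  by congr (_ * _ * _); exact/esym/smooth_map_derive.
- by apply: Uleft => i; rewrite weightl.
- apply: Uleft => i; have [j ji] := a_ne i; exists (lshift 1 j).
    by rewrite eq_lrshift.
  by rewrite !weightl.
- by move=> y; exists (f' y) => m; rewrite f'K.
Qed.

Lemma gram_rho p : gram (rho a) p = diag_mx (\row_m warp al m (p 0 U)).
Proof.
apply/matrixP => i j; rewrite !mxE rho_delta.
by case: eqVneq => [->|_]; rewrite ?mul1r ?mul0r.
Qed.

Lemma invmx_gram_rho p :
  invmx (gram (rho a) p) = diag_mx (\row_m (warp al m (p 0 U))^-1).
Proof.
rewrite gram_rho; set D := diag_mx _; set D' := diag_mx _.
have DD : D *m D' = 1%:M.
  rewrite /D mul_diag_mx; apply/matrixP => i j; rewrite !mxE.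
  by case: eqVneq => [->|_]; rewrite ?mulr0 //= mulr1n divff // gt_eqF // warp_gt0.
have [uD _] := mulmx1_unit DD.
by rewrite -[LHS]mulmx1 -DD mulmxA mulVmx // mul1mx.
Qed.

Lemma partial_gram_rho p i j l :
  partial l (fun q => gram (rho a) q i j) p
  = (i == j)%:R * (- (2 * al i * (l == U)%:R) * warp al i (p 0 U)).
Proof.
have -> : (fun q => gram (rho a) q i j) = fun q => (i == j)%:R * warp al i (q 0 U).
  by apply/funext => q; rewrite mxE rho_delta.
have sU : smooth_fun (fun q : V => q 0 U) by exact: smooth_coord.
rewrite partial_scale; last exact: smooth_warp.
by rewrite partial_warp // partial_coord (eq_sym U).
Qed.

Lemma christoffel_rho p m i j :
  christoffel (rho a) p m i j =
  - (j == m)%:R * al m * (i == U)%:R - (i == m)%:R * al m * (j == U)%:R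
  + (i == j)%:R * al i * (m == U)%:R * warp al i (p 0 U).
Proof.
rewrite /christoffel invmx_gram_rho (bigD1 m) //= big1 ?addr0 => [|s sm]; last first.
  by rewrite !mxE eq_sym (negPf sm) mul0r.
rewrite !partial_gram_rho !mxE eqxx mulr1n.
have w0 : warp al m (p 0 U) != 0 by rewrite gt_eqF // warp_gt0.
have E (x : 'I_(k + 1)) : (x == m)%:R * (al x * warp al x (p 0 U))
    = (x == m)%:R * (al m * warp al m (p 0 U)).
  by case: eqVneq => [->|_]; rewrite ?mul0r.
have -> : (j == m)%:R * (- (2 * al j * (i == U)%:R) * warp al j (p 0 U))
   = - 2 * (i == U)%:R * ((j == m)%:R * (al j * warp al j (p 0 U))) by ring.
have -> : (i == m)%:R * (- (2 * al i * (j == U)%:R) * warp al i (p 0 U))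
   = - 2 * (j == U)%:R * ((i == m)%:R * (al i * warp al i (p 0 U))) by ring.
rewrite !E.
have [mU|_] := eqVneq m U.
  rewrite mU warpU ?weightU //; move: (warp al i (p 0 U)) => y /=.
  by field.
move: w0; move: (warp al m (p 0 U)) (warp al i (p 0 U)) => x y x0 /=.
by field.
Qed.

(** The geodesic equations of rho read x_m'' = 2 al_m u' x_m' and
   u'' = - sum_i al_i exp(-2 al_i u) x_i'^2. *)
Lemma christoffel_rho_sum p (d : 'I_(k + 1) -> R) m :
  \sum_i \sum_j christoffel (rho a) p m i j * d i * d j
  = - (2 * al m * d U * d m)
    + (m == U)%:R * \sum_i al i * warp al i (p 0 U) * d i ^+ 2.
Proof.
have pick (f : 'I_(k + 1) -> R) n : \sum_s f s * (s == n)%:R = f n.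
  rewrite (bigD1 n) //= eqxx mulr1 big1 ?addr0 // => s /negPf ->.
  by rewrite mulr0.
transitivity (\sum_i (- (al m * d m * d i * (i == U)%:R)
   - al m * d U * d i * (i == m)%:R
   + (m == U)%:R * (al i * warp al i (p 0 U) * d i ^+ 2))).
  apply: eq_bigr => i _.
  transitivity (\sum_j (- (al m * (i == U)%:R * d i * d j * (j == m)%:R)
     - al m * (i == m)%:R * d i * d j * (j == U)%:R
     + al i * (m == U)%:R * warp al i (p 0 U) * d i * d j * (j == i)%:R)).
    by apply: eq_bigr => j _; rewrite christoffel_rho (eq_sym j i); ring.
  rewrite !big_split /= !sumrN !pick; ring.
by rewrite !big_split /= !sumrN !pick -mulr_sumr; ring.
Qed.

Variable i0 : 'I_k.
Hypothesis a0_gt0 : 0 < a 0 i0.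
Let A := a 0 i0.
Let A0 : A != 0. Proof. by rewrite gt_eqF. Qed.
Let I := lshift 1 i0 : 'I_(k + 1).
Let C s := expR (A * s) + expR (- (A * s)).
Let D s := expR (A * s) - expR (- (A * s)).

Let C_gt0 s : 0 < C s.
Proof. by rewrite addr_gt0 ?expR_gt0. Qed.

Let C0 s : C s != 0. Proof. by rewrite gt_eqF. Qed.

Let is_derive_lin (b s : R) : is_derive s (1 : R) (fun s => b * s) b.
Proof.
have := is_deriveZ b (is_derive_id s (1 : R)).
by rewrite [b *: 1]mulr1.
Qed.

Let dexp (b s : R) : is_derive s (1 : R) (fun s => expR (b * s)) (b * expR (b * s)).
Proof.
have := is_derive1_comp (is_derive_expR (b * s)) (is_derive_lin b s).
by rewrite mulrC.
Qed.

Let dC s : is_derive s (1 : R) C (A * D s).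
Proof.
have := is_deriveD (dexp A s) (dexp (- A) s).
have -> : A * expR (A * s) + - A * expR (- A * s) = A * D s.
  by rewrite /D -[- (A * s)]mulNr; ring.
congr is_derive; apply/funext => x.
by rewrite /C -mulNr.
Qed.

Let dD s : is_derive s (1 : R) D (A * C s).
Proof.
have := is_deriveB (dexp A s) (dexp (- A) s).
have -> : A * expR (A * s) - - A * expR (- A * s) = A * C s.
  by rewrite /C -[- (A * s)]mulNr; ring.
congr is_derive; apply/funext => x.
by rewrite /D -mulNr.
Qed.

Let CD s : C s ^+ 2 - D s ^+ 2 = 4.
Proof.
rewrite /C /D; have : expR (A * s) * expR (- (A * s)) = 1 by rewrite -expRD subrr expR0.
move: (expR _) (expR _) => x y xy.
transitivity (4 * (y * x)); first by ring.
by rewrite xy mulr1.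
Qed.

Let dVC s : is_derive s (1 : R) (fun s => (C s)^-1) (- (A * D s) / C s ^+ 2).
Proof.
apply: (is_derive_eq (is_deriveV (C0 s) (dC s))); rewrite /GRing.scale /=.
by have := C0 s; move: (C s) (D s) => x y x0; field.
Qed.

(** In the plane of e_i0 and f_1 put y = exp(A u) / A: the metric becomes
   (dx^2 + dy^2) / (A y)^2, that of a hyperbolic half-plane, and this curve is
   the unit speed parametrization of the half circle of radius 1 / (2 A) around
   the origin, C and D being 2 cosh (A s) and 2 sinh (A s). *)
Definition semicircle (s : R) : V :=
  \row_m ((m == I)%:R * ((2 * A)^-1 * (D s * (C s)^-1))
        + (m == U)%:R * (- A^-1 * ln (C s))).

Let vel (s : R) : V :=
  \row_m ((m == I)%:R * (2 * ((C s)^-1 * (C s)^-1))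
        + (m == U)%:R * (-1 * (D s * (C s)^-1))).

Let acc (s : R) : V :=
  \row_m ((m == I)%:R * (- (4 * A * D s / C s ^+ 3))
        + (m == U)%:R * (- (4 * A / C s ^+ 2))).

Let comb m (x y : R -> R) (s x' y' : R) :
  is_derive s (1 : R) x x' -> is_derive s (1 : R) y y' ->
  is_derive s (1 : R) (fun s => (m == I)%:R * x s + (m == U)%:R * y s)
    ((m == I)%:R * x' + (m == U)%:R * y').
Proof.
by move=> Hx Hy; apply: is_deriveD; exact: is_deriveZ.
Qed.

Let dDC s : is_derive s (1 : R) (fun s => D s * (C s)^-1) (4 * A / C s ^+ 2).
Proof.
apply: (is_derive_eq (is_derive_mulfun (dD s) (dVC s))).
rewrite -(CD s); move: (C s) (D s) (C0 s) => x y x0; field.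
exact: x0.
Qed.

Lemma derive_semicircle :
  (forall s, derivable semicircle s 1) /\ derive1 semicircle = vel.
Proof.
apply: derive1_row => s m; rewrite [X in is_derive _ _ _ X]mxE.
rewrite (_ : (fun s => _) = (fun s => (m == I)%:R * ((2 * A)^-1 * (D s * (C s)^-1))
        + (m == U)%:R * (- A^-1 * ln (C s)))); last first.
  by apply/funext => x; rewrite mxE.
apply: comb.
- apply: (is_derive_eq (is_deriveZ _ (dDC s))).
  rewrite /GRing.scale /=; field.
  by rewrite A0 C0.
- have dl := is_derive1_comp (is_derive1_ln (C_gt0 s)) (dC s).
  apply: (is_derive_eq (is_deriveZ (- A^-1) dl)).
  rewrite /GRing.scale /=; field.
  by rewrite A0 C0.
Qed.

Lemma derive_vel : (forall s, derivable vel s 1) /\ derive1 vel = acc.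
Proof.
apply: derive1_row => s m; rewrite [X in is_derive _ _ _ X]mxE.
rewrite (_ : (fun s => _) = (fun s => (m == I)%:R * (2 * ((C s)^-1 * (C s)^-1))
        + (m == U)%:R * (-1 * (D s * (C s)^-1)))); last first.
  by apply/funext => x; rewrite mxE.
apply: comb.
- apply: (is_derive_eq (is_deriveZ _ (is_derive_mulfun (dVC s) (dVC s)))).
  rewrite /GRing.scale /=; field.
  by rewrite C0.
- apply: (is_derive_eq (is_deriveZ _ (dDC s))).
  by rewrite /GRing.scale /= mulN1r.
Qed.

Let UI : (U == I) = false. Proof. by rewrite eq_rlshift. Qed.
Let IU : (I == U) = false. Proof. by rewrite eq_lrshift. Qed.

Lemma semicircle_height s : semicircle s 0 U = - A^-1 * ln (C s).
Proof. by rewrite mxE UI eqxx mul0r add0r mul1r. Qed.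

Lemma geodesic_semicircle : geodesic (rho a) semicircle.
Proof.
have [d1 E1] := derive_semicircle; have [d2 E2] := derive_vel.
split; first exact: d1.
rewrite E1 E2; split; first exact: d2.
move=> s m.
rewrite (christoffel_rho_sum _ (fun i => vel s 0 i)).
have velU : vel s 0 U = - (D s / C s).
  by rewrite mxE UI eqxx mul0r add0r mul1r mulN1r.
have velI : vel s 0 I = 2 * ((C s)^-1 * (C s)^-1).
  by rewrite mxE IU eqxx mul0r addr0 mul1r.
have velO j : j != I -> j != U -> vel s 0 j = 0.
  by move=> jI jU; rewrite mxE (negPf jI) (negPf jU) !mul0r addr0.
have accO j : j != I -> j != U -> acc s 0 j = 0.
  by move=> jI jU; rewrite mxE (negPf jI) (negPf jU) !mul0r addr0.
have accU : acc s 0 U = - (4 * A / C s ^+ 2).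
  by rewrite mxE UI eqxx mul0r add0r mul1r.
have accI : acc s 0 I = - (4 * A * D s / C s ^+ 3).
  by rewrite mxE IU eqxx mul0r addr0 mul1r.
have [->|mU] := eqVneq m U.
  rewrite weightU mulr0 !mul0r oppr0 add0r mul1r (bigD1 I) //= big1 => [|j jI].
    rewrite velI addr0 weightl /warp semicircle_height weightl -/A.
    rewrite (_ : - (2 * A * (- A^-1 * ln (C s))) = 2%:R * ln (C s)); last by field.
    rewrite expRM_natl lnK ?posrE // accU.
    by have := C0 s; move: (C s) => x x0; field.
  have [->|jU] := eqVneq j U; first by rewrite weightU !mul0r.
  by rewrite velO // expr0n mulr0.
rewrite mul0r addr0 velU.
have [->|mI] := eqVneq m I.
  rewrite velI weightl -/A accI.
  by have := C0 s; move: (C s) (D s) => x y x0; field.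
by rewrite accO // velO // mulr0 subr0.
Qed.

Lemma semicircle_top s : semicircle s 0 U <= semicircle 0 0 U.
Proof.
rewrite !semicircle_height !mulNr lerN2 ler_pM2l ?invr_gt0 //.
rewrite ler_ln ?posrE // /C mulr0 oppr0 expR0.
have x_gt0 := expR_gt0 (A * s); have xy := expRxMexpNx_1 (A * s).
rewrite -subr_ge0 -(pmulr_rge0 _ x_gt0).
have -> : expR (A * s) * (expR (A * s) + expR (- (A * s)) - (1 + 1))
        = (expR (A * s) - 1) ^+ 2 by rewrite mulrBr mulrDr xy; ring.
exact: sqr_ge0.
Qed.

Lemma semicircle_lt : semicircle 1 0 U < semicircle 0 0 U.
Proof.
rewrite !semicircle_height !mulNr ltrN2 ltr_pM2l ?invr_gt0 //.
rewrite ltr_ln ?posrE // /C mulr0 oppr0 expR0.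
have xy := expRxMexpNx_1 (A * 1).
have x1 : 1 < expR (A * 1) by rewrite expR_gt1 mulr1.
have y1 : expR (- (A * 1)) < 1 by rewrite expR_lt1 oppr_lt0 mulr1.
have : 0 < (expR (A * 1) - 1) * (1 - expR (- (A * 1))) by rewrite mulr_gt0 ?subr_gt0.
by move: xy {x1 y1}; move: (expR (A * 1)) (expR (- (A * 1))) => x y; nra.
Qed.

(** If the orbit of [phi] through [p] were the half circle, some phi_s would map
   the point at parameter 1 to the top; this phi_s raises every height by a
   positive constant, and so moves the top out of the half circle. *)
Lemma semicircle_not_homogeneous :
  (forall i : 'I_k, 0 < a 0 i) ->
  (forall i : 'I_k, exists j : 'I_k, a 0 j != a 0 i) ->
  ~ homogeneous_geodesic (rho a) semicircle.
Proof.
move=> a_gt0 a_ne [phi [p [[iso_phi phiD _] orb]]].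
have height s : exists d, forall q, phi s q 0 U = q 0 U + d.
  have [c [d [c2 H]]] := isometry_height a_gt0 a_ne (iso_phi (s / 2)).
  (* phi_s is the square of phi_(s/2), which squares the sign c away *)
  exists (c * d + d) => q.
  by rewrite {1}[s]splitr phiD /= !H mulrDr mulrA -expr2 c2 mul1r addrA.
have [s0 _ E0] : range (fun s => phi s p) (semicircle 0) by rewrite -orb; exists 0.
have [s1 _ E1] : range (fun s => phi s p) (semicircle 1) by rewrite -orb; exists 1.
have [d Hd] := height (s0 - s1).
have d_gt0 : 0 < d.
  have := Hd (semicircle 1); rewrite -{1}E1 -[phi _ (phi _ _)]/((phi _ \o phi _) p).
  by rewrite -phiD subrK E0; have := semicircle_lt; lra.
have [s _ Es] : range semicircle (phi (s0 - s1) (semicircle 0)).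
  by rewrite orb; exists (s0 - s1 + s0) => //; rewrite phiD /= E0.
have := semicircle_top s; rewrite Es Hd; lra.
Qed.

End WarpedGeometry.

Theorem theorem11 (R : realType) (l : nat) (ks : 'I_l -> nat)
    (a : 'rV[R]_(\sum_(q < l) ks q)%N) (t : R)
    (hl : (2 <= l)%N)
    (hks_noninc : forall q r : 'I_l, (q <= r)%N -> (ks r <= ks q)%N)
    (hks : forall q : 'I_l, (2 <= ks q)%N)
    (htrace : \tr (diag_mx a) = t)
    (ht : 0 < t)
    (h1 : forall j, 0 < a 0 j)
    (h2 : forall q i j, i \in block ks q -> j \in block ks q ->
       a 0 i = a 0 j)
    (h3 : forall (q r : 'I_l) i j, q != r -> i \in block ks q -> j \in block ks r ->
       - a 0 i * t <> - a 0 j * t) :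
  [/\ forall z z', SH R l ks z -> SH R l ks z' ->
        SH R l ks (SH_mul a z z') /\
        SH_act a (SH_mul a z z') = SH_act a z \o SH_act a z',
      forall z, SH R l ks z -> riemannian_isometry (rho a) (SH_act a z),
      forall p, exists2 z, SH R l ks z & SH_act a z (S_one R _) = p,
      forall z z', SH R l ks z -> SH R l ks z' ->
        SH_act a z (S_one R _) = SH_act a z' (S_one R _) <->
        exists2 h, prod_SO R l ks h & z' = SH_mul a z (SH_of_H h)
    & ~ geodesic_orbit (rho a)].
Proof.
split.
- by move=> z z' Hz Hz'; split; [exact: SH_closed|exact: SH_act_mul].
- by move=> z; exact: SH_act_isometry.
- by move=> p; exact: SH_transitive.
- by move=> z z'; exact: SH_stabilizer.
have i_of q : exists i : 'I_(\sum_(q < l) ks q)%N, tagnat.sig1 i = q.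
  have q_gt0 : (0 < ks q)%N by apply: leq_trans (hks q).
  by exists (tagnat.Rank q (Ordinal q_gt0)); rewrite tagnat.Rank1K.
have a_ne i : exists j, a 0 j != a 0 i.
  have [r rq] : exists r : 'I_l, r != tagnat.sig1 i.
    have l_gt0 : (0 < l)%N by apply: leq_trans hl.
    have [E|] := eqVneq (Ordinal l_gt0) (tagnat.sig1 i); last by exists (Ordinal l_gt0).
    by exists (Ordinal hl); rewrite -E.
  have [j jr] := i_of r; exists j; apply/negP => /eqP aij.
  apply: (h3 _ _ j i rq); last by rewrite aij.
  - by rewrite -jr mem_block_sig1.
  - exact: mem_block_sig1.
have [i0 _] := i_of (Ordinal hl).
move=> go; apply: (semicircle_not_homogeneous (h1 i0) h1 a_ne).
exact/go/geodesic_semicircle.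
Qed.
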